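(* The homogeneous space $(E_{7,\mathbb{R}})^{\mathbb{C}}/((E_{7,\mathbb{R}})^{\mathbb{C}})_{\underset{\cdot}{1}}$ is homeomorphic to the space $(\mathfrak{M}_{\mathbb{R}})^{\mathbb{C}}$: $(E_{7,\mathbb{R}})^{\mathbb{C}}/((E_{7,\mathbb{R}})^{\mathbb{C}})_{\underset{\cdot}{1}}\simeq(\mathfrak{M}_{\mathbb{R}})^{\mathbb{C}}$. In particular, the group $(E_{7,\mathbb{R}})^{\mathbb{C}}$ is connected.
   Context: Let $(\mathfrak{J}_{\mathbb{R}})^{\mathbb{C}}$ be the space of symmetric $3\times3$ complex matrices with $X\circ Y=\frac12(XY+YX)$, $(X,Y)=\mathrm{tr}(X\circ Y)$, and $X\times Y=\frac12\bigl(2X\circ Y-\mathrm{tr}(X)Y-\mathrm{tr}(Y)X+(\mathrm{tr}(X)\mathrm{tr}(Y)-(X,Y))E\bigr)$. Let $(\mathfrak{e}_{6,\mathbb{R}})^{\mathbb{C}}=\{\phi\in\mathrm{Hom}_{\mathbb{C}}((\mathfrak{J}_{\mathbb{R}})^{\mathbb{C}})\mid(\phi X,X\times X)=0\ \forall X\}$; ${}^t\phi$ is the transpose with respect to $(X,Y)$. For $X\in(\mathfrak{J}_{\mathbb{R}})^{\mathbb{C}}$ let $\tilde X Z=X\circ Z$, and $X\vee W=[\tilde X,\tilde W]+(X\circ W-\frac13(X,W)E)^{\sim}\in(\mathfrak{e}_{6,\mathbb{R}})^{\mathbb{C}}$. Let $(\mathfrak{P}_{\mathbb{R}})^{\mathbb{C}}=(\mathfrak{J}_{\mathbb{R}})^{\mathbb{C}}\oplus(\mathfrak{J}_{\mathbb{R}})^{\mathbb{C}}\oplus\mathbb{C}\oplus\mathbb{C}$.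 For $\phi\in(\mathfrak{e}_{6,\mathbb{R}})^{\mathbb{C}}$, $A,B\in(\mathfrak{J}_{\mathbb{R}})^{\mathbb{C}}$, $\nu\in\mathbb{C}$, define $\Phi(\phi,A,B,\nu)(X,Y,\xi,\eta)=(\phi X-\frac13\nu X+2B\times Y+\eta A,\ 2A\times X-{}^t\phi Y+\frac13\nu Y+\xi B,\ (A,Y)+\nu\xi,\ (B,X)-\nu\eta)$. For $P=(X,Y,\xi,\eta)$, $Q=(Z,W,\zeta,\omega)$ define $P\times Q=\Phi(\phi,A,B,\nu)$ with $\phi=-\frac12(X\vee W+Z\vee Y)$, $A=-\frac14(2Y\times W-\xi Z-\zeta X)$, $B=\frac14(2X\times Z-\eta W-\omega Y)$, $\nu=\frac18((X,W)+(Z,Y)-3(\xi\omega+\zeta\eta))$. $(E_{7,\mathbb{R}})^{\mathbb{C}}=\{\alpha\in\mathrm{Iso}_{\mathbb{C}}((\mathfrak{P}_{\mathbb{R}})^{\mathbb{C}})\mid\alpha(P\times Q)\alpha^{-1}=\alpha P\times\alpha Q\ \forall P,Q\}$, where $\mathrm{Iso}_{\mathbb{C}}(V)$ is the group of $\mathbb{C}$-linear automorphisms of $V$. Let $\underset{\cdot}{1}=(0,0,0,1)\in(\mathfrak{P}_{\mathbb{R}})^{\mathbb{C}}$ and let $((E_{7,\mathbb{R}})^{\mathbb{C}})_{\underset{\cdot}{1}}$ be the subgroup of elements fixing $\underset{\cdot}{1}$. Let $(\mathfrak{M}_{\mathbb{R}})^{\mathbb{C}}=\{P\in(\mathfrak{P}_{\mathbb{R}})^{\mathbb{C}}\mid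 P\times P=0,\ P\neq0\}$. *)

(* Defs.v *)
From HB Require Import structures.
From mathcomp Require Import all_boot all_order all_algebra.
From mathcomp Require Import all_classical all_reals all_analysis.
From mathcomp Require Import complex ring.

Set Implicit Arguments.
Unset Strict Implicit.
Unset Printing Implicit Defensive.

Import Order.TTheory GRing.Theory Num.Theory.
Import numFieldNormedType.Exports.

Local Open Scope classical_set_scope.
Local Open Scope ring_scope.
Local Open Scope quotient_scope.

(* The algebra is developed over an arbitrary [K : numClosedFieldType]; the
   complex field of the mathematics is the instance [K := R[i]] with
   [R : realType]. *)

Section SymmetricMatrices.
Variable K : numClosedFieldType.

Definition symm : {pred 'M[K]_3} := [pred X | X^T == X].

Fact symm_submod_closed : submod_closed symm.
Proof.
split=> [|a X Y]; rewrite !inE ?trmx0// => /eqP XE /eqP YE.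
by rewrite linearP/= XE YE.
Qed.

HB.instance Definition _ :=
  GRing.isSubmodClosed.Build K 'M[K]_3 symm symm_submod_closed.

Record symmx := SymMx { symval :> 'M[K]_3; _ : symval \in symm }.

HB.instance Definition _ := [isSub for symval].
HB.instance Definition _ := [Choice of symmx by <:].
HB.instance Definition _ := [SubChoice_isSubLmodule of symmx by <:].
HB.instance Definition _ :=
  Topological.copy symmx (initial_topology symval).

End SymmetricMatrices.

Section Jordan.
Variable K : numClosedFieldType.
Local Notation J := (symmx K).

Fact jmul_symm (X Y : J) :
  2^-1 *: (X *m Y + Y *m X) \in @symm K.
Proof.
rewrite inE linearZ/= linearD/= !trmx_mul.
case: X Y => [X /eqP/= ->] [Y /eqP/= ->].
by rewrite addrC.
Qed.

(* The Jordan product X o Y *)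
Definition jmul (X Y : J) : J := SymMx (jmul_symm X Y).

Fact jone_symm : 1%:M \in @symm K.
Proof. by rewrite inE trmx1. Qed.

(* E *)
Definition jone : J := SymMx jone_symm.

(* (X, Y) = tr (X o Y) *)
Definition jform (X Y : J) : K := \tr (jmul X Y).

(* X x Y *)
Definition jcross (X Y : J) : J :=
  2^-1 *: (2 *: jmul X Y - \tr X *: Y - \tr Y *: X
           + (\tr X * \tr Y - jform X Y) *: jone).

Definition e6 : set (J -> J) :=
  [set phi | linear phi /\ forall X, jform (phi X) (jcross X X) = 0].

Fact jbasis_symm (i j : 'I_3) :
  2^-1 *: (delta_mx i j + delta_mx j i) \in @symm K.
Proof. by rewrite inE linearZ/= linearD/= !trmx_delta addrC. Qed.

Definition jbasis (i j : 'I_3) : J := SymMx (jbasis_symm i j).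

Lemma jbasisC i j : jbasis i j = jbasis j i.
Proof. by apply: val_inj; rewrite /= addrC. Qed.

Fact jtr_symm (phi : J -> J) (Y : J) :
  (\matrix_(i, j) jform (phi (jbasis i j)) Y) \in @symm K.
Proof. by rewrite inE; apply/eqP/matrixP=> i j; rewrite !mxE jbasisC. Qed.

(* The transpose of [phi] with respect to [jform]: for [phi] linear it is the
   only map such that [jform (phi X) Y = jform X (jtr phi Y)], see [jtrP] and
   [jtr_uniq].  The formula holds because the (i, j) entry of Z : J is
   [jform (jbasis i j) Z]. *)
Definition jtr (phi : J -> J) (Y : J) : J := SymMx (jtr_symm phi Y).

Lemma symmE (X : J) i j : X i j = X j i.
Proof. by case: X => X /= /eqP {1}<-; rewrite mxE. Qed.

Lemma jformE X Y : jform X Y = \sum_i \sum_j X i j * Y i j.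
Proof.
have half (t : K) : 2^-1 * (t + t) = t by field.
rewrite /jform /= mxtraceZ mxtraceD (mxtrace_mulC Y) half.
by apply: eq_bigr => i _; rewrite mxE; apply: eq_bigr => j _; rewrite (symmE Y).
Qed.

Lemma jformC X Y : jform X Y = jform Y X.
Proof.
rewrite !jformE; apply: eq_bigr => i _; apply: eq_bigr => j _.
exact: mulrC.
Qed.

Lemma jform_jbasis i j Z : jform (jbasis i j) Z = Z i j.
Proof.
rewrite jformE.
under eq_bigr do under eq_bigr do rewrite !mxE -mulrA mulrDl mulrDr.
under eq_bigr do rewrite big_split/=.
rewrite big_split/= (bigD1 i)//= (bigD1 j)//= !eqxx mul1r.
rewrite [X in _ + X + _ + _]big1 => [|k /negPf->]; last first.
  by rewrite andbF mul0r mulr0.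
rewrite [X in _ + _ + X + _]big1 => [|k /negPf kn]; last first.
  by rewrite big1// => l _; rewrite kn mul0r mulr0.
rewrite (bigD1 j)//= (bigD1 i)//= !eqxx mul1r.
rewrite [X in _ + (_ + X + _)]big1 => [|k /negPf->]; last first.
  by rewrite andbF mul0r mulr0.
rewrite [X in _ + (_ + _ + X)]big1 => [|k /negPf kn]; last first.
  by rewrite big1// => l _; rewrite kn mul0r mulr0.
by rewrite !addr0 (symmE Z j) -mulrDl; field.
Qed.

Lemma jtrP phi X Y : linear phi -> jform (phi X) Y = jform X (jtr phi Y).
Proof.
move=> lphi.
have phi0 : phi 0 = 0.
  by have := lphi (-1) 0 0; rewrite scaler0 add0r scaleN1r addNr.
have jform0 Z : jform 0 Z = 0.
  by rewrite jformE big1// => i _; rewrite big1// => j _; rewrite mxE mul0r.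
have jformP a U V Z : jform (a *: U + V) Z = a * jform U Z + jform V Z.
  rewrite !jformE mulr_sumr -big_split; apply: eq_bigr => i _ /=.
  rewrite mulr_sumr -big_split; apply: eq_bigr => j _ /=.
  by rewrite !mxE mulrDl mulrA.
have lin (r : seq ('I_3 * 'I_3)) :
    jform (phi (\sum_(p <- r) X p.1 p.2 *: jbasis p.1 p.2)) Y =
    \sum_(p <- r) X p.1 p.2 * jform (phi (jbasis p.1 p.2)) Y.
  elim: r => [|p r IH]; first by rewrite !big_nil phi0 jform0.
  by rewrite !big_cons lphi jformP IH.
have {1}-> : X = \sum_p X p.1 p.2 *: jbasis p.1 p.2.
  apply: val_inj; rewrite raddf_sum/=.
  under eq_bigr do rewrite scalerDr scalerDr.
  rewrite big_split/= -(pair_bigA _ (fun i j => X i j *: (2^-1 *: delta_mx i j)))/=.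
  rewrite -(pair_bigA _ (fun i j => X i j *: (2^-1 *: delta_mx j i)))/=.
  rewrite [X in _ + X]exchange_big/=.
  under [X in _ + X]eq_bigr do under eq_bigr do rewrite symmE.
  rewrite -mulr2n [LHS]matrix_sum_delta -scaler_nat scaler_sumr.
  apply: eq_bigr => i _; rewrite scaler_sumr; apply: eq_bigr => j _.
  by rewrite !scalerA; congr (_ *: _); field.
rewrite lin jformE pair_bigA/=.
by apply: eq_bigr => p _; rewrite mxE.
Qed.

Lemma jtr_uniq phi psi : linear phi ->
  (forall X Y, jform (phi X) Y = jform X (psi Y)) -> psi = jtr phi.
Proof.
move=> lphi psiP; apply/funext => Y; apply: val_inj; apply/matrixP => i j /=.
by rewrite mxE psiP jform_jbasis.
Qed.

(* X v W = [X~, W~] + (X o W - 1/3 (X, W) E)~ *)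
Definition jvee (X W : J) : J -> J := fun Z =>
  jmul X (jmul W Z) - jmul W (jmul X Z)
  + jmul (jmul X W - (3^-1 * jform X W) *: jone) Z.

Lemma jform_mx (X Y : J) : jform X Y = \tr (X *m Y).
Proof.
rewrite jformE; apply: eq_bigr => i _; rewrite mxE.
by apply: eq_bigr => j _; rewrite (symmE Y).
Qed.

Lemma jcross_mx (Z : J) :
  Z *m jcross Z Z = (Z *m jcross Z Z) 0 0 *: 1%:M.
Proof.
have -> : jcross Z Z = Z *m Z - \tr Z *: (Z : 'M[K]_3)
            + (2^-1 * (\tr Z * \tr Z - \tr (Z *m Z))) *: 1%:M :> 'M[K]_3.
  rewrite /jcross jform_mx; case: Z => Z sZ /=.
  apply/matrixP => i j; rewrite !mxE; set t := \tr Z; set u := \tr _.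
  by set s := \sum_k _; field.
move: (Z : 'M[K]_3) => {}Z.
rewrite /mxtrace.
have big3 (F : 'I_3 -> K) : \sum_i F i = F 0 + F 1 + F 2%:R.
  by rewrite !big_ord_recl big_ord0 addr0 addrA; congr (_ + F _ + F _);
    exact: val_inj.
have I3 (i : 'I_3) : [\/ i = 0, i = 1 | i = 2%:R].
  by case: i => [[|[|[|]]]] //= h;
    [constructor 1|constructor 2|constructor 3]; exact: val_inj.
apply/matrixP => i j; do ?rewrite !(mxE, big3).
by case: (I3 i) => ->; case: (I3 j) => -> /=;
  rewrite ?mulr1 ?mulr0 ?mulr1n ?mulr0n /=; field.
Qed.

Lemma jvee_e6 (X W : J) : e6 (jvee X W).
Proof.
split=> [a U V|Z].
  have jmulPr A : linear (jmul A).
    move=> k B C; apply: val_inj => /=.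
    rewrite mulmxDr mulmxDl -scalemxAr -scalemxAl addrACA -scalerDr.
    by rewrite [LHS]scalerDr !scalerA (mulrC k).
  rewrite /jvee !jmulPr !scalerDr scalerN opprD.
  by rewrite [X in X + _]addrACA [LHS]addrACA.
pose T := jmul X W - (3^-1 * jform X W) *: jone.
have trT : \tr T = 0.
  by rewrite raddfB/= [X in _ - X]mxtraceZ mxtrace1 -[X in X - _]/(jform X W); field.
have trmxJ (Y : J) : Y^T = Y :> 'M[K]_3 by case: Y => Y /= /eqP.
set N := jcross Z Z.
have [c ZN] : exists c, Z *m N = c *: 1%:M.
  by eexists; exact: jcross_mx.
have NZ : N *m Z = Z *m N.
  by rewrite -[LHS]trmxK trmx_mul !trmxJ ZN linearZ/= trmx1.
clearbody N.
have jmul_tr (A : J) (B : J) : \tr (jmul A B *m N) =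
    2^-1 * (\tr (A *m (B *m N)) + \tr (A *m (N *m B))).
  by rewrite /= -scalemxAl mxtraceZ mulmxDl mxtraceD -!mulmxA
    (mxtrace_mulC B) -mulmxA.
have vD (A B : J) : (A + B : J) = (A : 'M[K]_3) + B :> 'M[K]_3 by [].
have trB (A B : 'M[K]_3) : \tr (A - B) = \tr A - \tr B by exact: raddfB.
have vB (A B : J) : (A - B : J) = (A : 'M[K]_3) - B :> 'M[K]_3 by [].
rewrite jform_mx /jvee -/T vD vB mulmxDl mulmxBl mxtraceD trB !jmul_tr.
have trTN : \tr (T *m (Z *m N)) = 0.
  by rewrite ZN -scalemxAr mulmx1 mxtraceZ trT mulr0.
rewrite NZ trTN !(mulr0, addr0) -mulrBr.
have key (A B : J) : \tr (A *m (jmul B Z *m N)) + \tr (A *m (N *m jmul B Z)) =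
    2^-1 * (\tr (A *m (Z *m (B *m N))) + \tr (A *m (N *m (B *m Z)))
            + 2 * (c * \tr (A *m B))).
  have ZN1 (C : 'M[K]_3) : \tr (C *m (Z *m N)) = c * \tr C.
    by rewrite ZN -scalemxAr mulmx1 mxtraceZ.
  have -> : jmul B Z = 2^-1 *: (B *m Z + Z *m B) :> 'M[K]_3 by [].
  rewrite -scalemxAl -!scalemxAr !mxtraceZ -mulrDr mulmxDl !mulmxDr.
  rewrite !mxtraceD -!mulmxA [A *m (B *m (Z *m N))]mulmxA ZN1.
  have -> : N *m (Z *m B) = c *: (B : 'M[K]_3).
    by rewrite mulmxA NZ ZN -scalemxAl mul1mx.
  by rewrite -scalemxAr mxtraceZ; ring.
rewrite !key.
have -> : \tr (W *m (Z *m (X *m N))) = \tr (X *m (N *m (W *m Z))).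
  by rewrite mulmxA mxtrace_mulC -mulmxA.
have -> : \tr (W *m (N *m (X *m Z))) = \tr (X *m (Z *m (W *m N))).
  by rewrite mulmxA mxtrace_mulC -mulmxA.
rewrite (mxtrace_mulC W); ring.
Qed.

Lemma e6_lincomb (a : K) (phi psi : J -> J) : e6 phi -> e6 psi ->
  e6 (fun V => a *: (phi V + psi V)).
Proof.
move=> [lphi ephi] [lpsi epsi]; split=> [k U V|X].
  by rewrite lphi lpsi addrACA -scalerDr [LHS]scalerDr !scalerA (mulrC k).
have vS (c : K) (A B : J) :
  (c *: (A + B) : J) = c *: ((A : 'M[K]_3) + B) :> 'M[K]_3 by [].
rewrite jform_mx vS -scalemxAl mulmxDl mxtraceZ mxtraceD -!jform_mx.
by rewrite ephi epsi addr0 mulr0.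
Qed.

End Jordan.
Section Freudenthal.
Variable K : numClosedFieldType.
Local Notation J := (symmx K).

Definition freud : Type := J * J * K * K.
HB.instance Definition _ := GRing.Lmodule.on freud.
HB.instance Definition _ := Topological.on freud.

(* Phi(phi, A, B, nu), meaningful for [e6 phi]; see [fcross_e6] *)
Definition fPhi (phi : J -> J) (A B : J) (nu : K) : freud -> freud :=
  fun P => let: (X, Y, xi, eta) := P in
  (phi X - (3^-1 * nu) *: X + 2 *: jcross B Y + eta *: A,
   2 *: jcross A X - jtr phi Y + (3^-1 * nu) *: Y + xi *: B,
   jform A Y + nu * xi,
   jform B X - nu * eta).

(* The endomorphism P x Q *)
Definition fcross (P Q : freud) : freud -> freud :=
  let: (X, Y, xi, eta) := P in
  let: (Z, W, zeta, omega) := Q in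
  fPhi (fun V => - 2^-1 *: (jvee X W V + jvee Z Y V))
       (- 4^-1 *: (2 *: jcross Y W - xi *: Z - zeta *: X))
       (4^-1 *: (2 *: jcross X Z - eta *: W - omega *: Y))
       (8^-1 * (jform X W + jform Z Y - 3 * (xi * omega + zeta * eta))).

Lemma fcross_e6 (X Y Z W : J) :
  e6 (fun V => - 2^-1 *: (jvee X W V + jvee Z Y V)).
Proof. exact: e6_lincomb (jvee_e6 X W) (jvee_e6 Z Y). Qed.

Definition dot1 : freud := (0, 0, 0, 1).

Definition fM : set freud :=
  [set P | fcross P P = (fun=> 0) /\ P <> 0].

(* Iso_C(P): the group of linear automorphisms of P.  Its topology, that of
   pointwise convergence, is the usual one since P is finite-dimensional. *)
Record fiso := FIso {
  fiso_fun :> freud -> freud;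
  _ : `[< linear fiso_fun /\ bijective fiso_fun >] }.

HB.instance Definition _ := [isSub for fiso_fun].
HB.instance Definition _ := [Choice of fiso by <:].
HB.instance Definition _ :=
  Topological.copy fiso
    (initial_topology (fiso_fun : fiso -> {ptws freud -> freud})).

Lemma fisoP (a : fiso) : linear a /\ bijective a.
Proof. by case: a => a /= /asboolP. Qed.

Fact fiso1_subproof :
  `[< linear (@idfun freud) /\ bijective (@idfun freud) >].
Proof. by apply/asboolP; split=> //; exists idfun. Qed.

Fact fisoM_subproof (a b : fiso) :
  `[< linear (a \o b) /\ bijective (a \o b) >].
Proof.
apply/asboolP; have [la ba] := fisoP a; have [lb bb] := fisoP b.
by split; [move=> k u v; rewrite /= lb la | exact: bij_comp].
Qed.

Fact fiso_inv_ex (a : fiso) : exists g, cancel a g /\ cancel g a.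
Proof. by have [_ [g ag ga]] := fisoP a; exists g. Qed.

Definition fiso_inv_fun (a : fiso) : freud -> freud :=
  projT1 (cid (fiso_inv_ex a)).

Lemma fiso_funK (a : fiso) : cancel a (fiso_inv_fun a).
Proof. by rewrite /fiso_inv_fun; case: cid => g []. Qed.

Lemma fiso_invK (a : fiso) : cancel (fiso_inv_fun a) a.
Proof. by rewrite /fiso_inv_fun; case: cid => g []. Qed.

Fact fisoV_subproof (a : fiso) :
  `[< linear (fiso_inv_fun a) /\ bijective (fiso_inv_fun a) >].
Proof.
apply/asboolP; have [la ba] := fisoP a; split; last first.
  by exists a; [exact: fiso_invK | exact: fiso_funK].
move=> k u v; apply: (can_inj (@fiso_funK a)).
by rewrite la !fiso_invK.
Qed.

Definition fiso1 := FIso fiso1_subproof.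
Definition fisoM a b := FIso (fisoM_subproof a b).
Definition fisoV a := FIso (fisoV_subproof a).

Fact fisoA : associative fisoM.
Proof. by move=> a b c; exact: val_inj. Qed.
Fact fiso1g : left_id fiso1 fisoM.
Proof. by move=> a; exact: val_inj. Qed.
Fact fisog1 : right_id fiso1 fisoM.
Proof. by move=> a; exact: val_inj. Qed.
Fact fisoVg : left_inverse fiso1 fisoV fisoM.
Proof. by move=> a; apply/val_inj/funext => P /=; rewrite fiso_funK. Qed.
Fact fisogV : right_inverse fiso1 fisoV fisoM.
Proof. by move=> a; apply/val_inj/funext => P /=; rewrite fiso_invK. Qed.

HB.instance Definition _ :=
  isGroup.Build fiso fisoA fiso1g fisog1 fisoVg fisogV.

Lemma fisoME (a b : fiso) P : (a * b)%g P = a (b P).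
Proof. by []. Qed.

Definition E7 : set fiso :=
  [set a : fiso | forall P Q, a \o fcross P Q \o (a^-1)%g = fcross (a P) (a Q)].

(* The stabilizer of [dot1] *)
Definition E7_dot1 : set fiso := [set a : fiso | E7 a /\ a dot1 = dot1].

Lemma E7_1 : E7 1%g.
Proof.
by move=> P Q; rewrite invg1.
Qed.

Lemma E7M (a b : fiso) : E7 a -> E7 b -> E7 (a * b)%g.
Proof.
move=> Ea Eb P Q; rewrite invgM !fisoME -Ea -Eb.
by apply/funext.
Qed.

Lemma E7V (a : fiso) : E7 a -> E7 (a^-1)%g.
Proof.
move=> Ea P Q; rewrite invgK; apply/funext => S /=.
have aK T : a ((a^-1)%g T) = T by rewrite -fisoME mulgV.
have Ka T : (a^-1)%g (a T) = T by rewrite -fisoME mulVg.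
have := congr1 (@^~ (a S)) (Ea ((a^-1)%g P) ((a^-1)%g Q)).
by rewrite !aK [LHS]/comp Ka => <-; exact: Ka.
Qed.

Lemma E7_dot1_1 : E7_dot1 1%g.
Proof. by split=> //; exact: E7_1. Qed.

Lemma E7_dot1M (a b : fiso) : E7_dot1 a -> E7_dot1 b -> E7_dot1 (a * b)%g.
Proof.
move=> [Ea a1] [Eb b1]; split; first exact: E7M.
by rewrite fisoME b1 a1.
Qed.

Lemma E7_dot1V (a : fiso) : E7_dot1 a -> E7_dot1 (a^-1)%g.
Proof.
move=> [Ea a1]; split; first exact: E7V.
by rewrite -{1}a1 -fisoME mulVg.
Qed.

(* a and b are in the same left coset of the stabilizer *)
Definition E7_coset (a b : E7) : bool :=
  `[< E7_dot1 ((set_val a)^-1 * set_val b)%g >].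

Fact E7_coset_refl : reflexive E7_coset.
Proof. by move=> a; apply/asboolP; rewrite mulVg; exact: E7_dot1_1. Qed.

Fact E7_coset_sym : symmetric E7_coset.
Proof.
move=> a b; apply/asbool_equiv_eq; split=> /E7_dot1V; rewrite invgM invgK //.
Qed.

Fact E7_coset_trans : transitive E7_coset.
Proof.
move=> b a c /asboolP ab /asboolP bc; apply/asboolP.
by have := E7_dot1M ab bc; rewrite -mulgA mulVKg.
Qed.

Canonical E7_coset_equiv :=
  EquivRel E7_coset E7_coset_refl E7_coset_sym E7_coset_trans.

Definition E7_homogeneous : topologicalType :=
  quotient_topology {eq_quot E7_coset}.

End Freudenthal.

Arguments fM K : clear implicits.
Arguments E7 K : clear implicits.
Arguments E7_dot1 K : clear implicits.

Definition homeomorphic (S T : topologicalType) :=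
  exists f : S -> T, exists g : T -> S,
    [/\ cancel f g, cancel g f, continuous f & continuous g].

(* Main.v *)
Require Import Defs.
From mathcomp Require Import all_boot all_order all_algebra.
From mathcomp Require Import all_classical all_reals all_analysis.
From mathcomp Require Import complex ring.

Set Implicit Arguments.
Unset Strict Implicit.
Unset Printing Implicit Defensive.

Import Order.TTheory GRing.Theory Num.Theory.
Import numFieldNormedType.Exports.

Local Open Scope classical_set_scope.
Local Open Scope ring_scope.

(* The group contains the translations [tau a] = exp Phi(0, a, 0, 0), their
   images [tauV a] under the duality (X, Y, xi, eta) |-> (-Y, X, -eta, xi), and
   the transvections of SL_3 acting by X |-> g X g^T, Y |-> g^-T Y g^-1.  Let
   [gen] be the subgroup that these one-parameter families generate.

   If P = (X, Y, xi, eta) in M has eta != 0, the equations P x P = 0 determine Y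
   and xi from X and eta, and P is the image of (0, 0, 0, 1) under an element of
   [gen] depending rationally on (X, eta).  Some [tauV b] moves any nonzero P
   into the region eta != 0.  Hence [gen] acts transitively on M and the orbit
   map has local continuous sections, which gives the homeomorphism.

   For connectedness one shows that [gen] is the whole group.  After
   multiplication by an element of [gen], alpha fixes (0, 0, 0, 1) and then also
   (0, 0, 1, 0); commuting with the cross product of these two it preserves the
   four summands, and its restriction phi to the first one preserves the
   determinant and the matrices with vanishing adjugate, so that
   phi(E_ii) = u_i u_i^T.  Dividing by the matrix with columns u_i, whose
   determinant can be taken to be 1, reduces phi to a diagonal conjugation; and
   SL_3 is generated by transvections.  Each generator lies on a path through
   the identity. *)

(** * Polynomial formulas in the fourteen coordinates *)

Section CoordinateOperations.
Variable K : numClosedFieldType.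

(* Symmetric 3x3 matrices by their entries. *)
Record vec6 := V6 { v11 : K; v22 : K; v33 : K; v23 : K; v13 : K; v12 : K }.

Definition add6 (x y : vec6) := V6 (v11 x + v11 y) (v22 x + v22 y)
  (v33 x + v33 y) (v23 x + v23 y) (v13 x + v13 y) (v12 x + v12 y).
Definition scale6 (k : K) (x : vec6) := V6 (k * v11 x) (k * v22 x)
  (k * v33 x) (k * v23 x) (k * v13 x) (k * v12 x).
Definition dot6 (x y : vec6) := v11 x * v11 y + v22 x * v22 y + v33 x * v33 y
  + 2 * (v23 x * v23 y + v13 x * v13 y + v12 x * v12 y).
(* [sharp6] is twice the cross product, [adj6 x] the cross square of [x]. *)
Definition sharp6 (x y : vec6) := V6
  (v22 x * v33 y + v33 x * v22 y - 2 * v23 x * v23 y)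
  (v11 x * v33 y + v33 x * v11 y - 2 * v13 x * v13 y)
  (v11 x * v22 y + v22 x * v11 y - 2 * v12 x * v12 y)
  (v13 x * v12 y + v12 x * v13 y - v11 x * v23 y - v23 x * v11 y)
  (v12 x * v23 y + v23 x * v12 y - v22 x * v13 y - v13 x * v22 y)
  (v13 x * v23 y + v23 x * v13 y - v33 x * v12 y - v12 x * v33 y).
Definition adj6 (x : vec6) := V6
  (v22 x * v33 x - v23 x ^+ 2)
  (v11 x * v33 x - v13 x ^+ 2)
  (v11 x * v22 x - v12 x ^+ 2)
  (v13 x * v12 x - v11 x * v23 x)
  (v12 x * v23 x - v22 x * v13 x)
  (v13 x * v23 x - v33 x * v12 x).
Definition det6 (x : vec6) := v11 x * v22 x * v33 x
  + 2 * v23 x * v13 x * v12 x - v11 x * v23 x ^+ 2 - v22 x * v13 x ^+ 2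
  - v33 x * v12 x ^+ 2.
Definition zero6 := V6 0 0 0 0 0 0.
Definition one6 := V6 1 1 1 0 0 0.

(* XWU + UWX *)
Definition trip6 (x w u : vec6) :=
  let xw11 := v11 x * v11 w + v12 x * v12 w + v13 x * v13 w in
  let xw12 := v11 x * v12 w + v12 x * v22 w + v13 x * v23 w in
  let xw13 := v11 x * v13 w + v12 x * v23 w + v13 x * v33 w in
  let xw21 := v12 x * v11 w + v22 x * v12 w + v23 x * v13 w in
  let xw22 := v12 x * v12 w + v22 x * v22 w + v23 x * v23 w in
  let xw23 := v12 x * v13 w + v22 x * v23 w + v23 x * v33 w in
  let xw31 := v13 x * v11 w + v23 x * v12 w + v33 x * v13 w in
  let xw32 := v13 x * v12 w + v23 x * v22 w + v33 x * v23 w in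
  let xw33 := v13 x * v13 w + v23 x * v23 w + v33 x * v33 w in
  V6 (2 * (xw11 * v11 u + xw12 * v12 u + xw13 * v13 u))
     (2 * (xw21 * v12 u + xw22 * v22 u + xw23 * v23 u))
     (2 * (xw31 * v13 u + xw32 * v23 u + xw33 * v33 u))
     (xw21 * v13 u + xw22 * v23 u + xw23 * v33 u
      + (xw31 * v12 u + xw32 * v22 u + xw33 * v23 u))
     (xw11 * v13 u + xw12 * v23 u + xw13 * v33 u
      + (xw31 * v11 u + xw32 * v12 u + xw33 * v13 u))
     (xw11 * v12 u + xw12 * v22 u + xw13 * v23 u
      + (xw21 * v11 u + xw22 * v12 u + xw23 * v13 u)).

Record mat3 := M3 { m11 : K; m12 : K; m13 : K; m21 : K; m22 : K; m23 : K;
  m31 : K; m32 : K; m33 : K }.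

Definition mul3 (g h : mat3) : mat3 := M3
  (m11 g * m11 h + m12 g * m21 h + m13 g * m31 h)
  (m11 g * m12 h + m12 g * m22 h + m13 g * m32 h)
  (m11 g * m13 h + m12 g * m23 h + m13 g * m33 h)
  (m21 g * m11 h + m22 g * m21 h + m23 g * m31 h)
  (m21 g * m12 h + m22 g * m22 h + m23 g * m32 h)
  (m21 g * m13 h + m22 g * m23 h + m23 g * m33 h)
  (m31 g * m11 h + m32 g * m21 h + m33 g * m31 h)
  (m31 g * m12 h + m32 g * m22 h + m33 g * m32 h)
  (m31 g * m13 h + m32 g * m23 h + m33 g * m33 h).

Definition one3 : mat3 := M3 1 0 0 0 1 0 0 0 1.

Definition det3 (g : mat3) : K :=
  m11 g * (m22 g * m33 g - m23 g * m32 g)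
  - m12 g * (m21 g * m33 g - m23 g * m31 g)
  + m13 g * (m21 g * m32 g - m22 g * m31 g).

(* u^T x w *)
Definition row6 (x : vec6) (u1 u2 u3 w1 w2 w3 : K) : K :=
  u1 * (v11 x * w1 + v12 x * w2 + v13 x * w3)
  + u2 * (v12 x * w1 + v22 x * w2 + v23 x * w3)
  + u3 * (v13 x * w1 + v23 x * w2 + v33 x * w3).

(* g x g^T *)
Definition conj6 (g : mat3) (x : vec6) : vec6 := V6
  (row6 x (m11 g) (m12 g) (m13 g) (m11 g) (m12 g) (m13 g))
  (row6 x (m21 g) (m22 g) (m23 g) (m21 g) (m22 g) (m23 g))
  (row6 x (m31 g) (m32 g) (m33 g) (m31 g) (m32 g) (m33 g))
  (row6 x (m21 g) (m22 g) (m23 g) (m31 g) (m32 g) (m33 g))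
  (row6 x (m11 g) (m12 g) (m13 g) (m31 g) (m32 g) (m33 g))
  (row6 x (m11 g) (m12 g) (m13 g) (m21 g) (m22 g) (m23 g)).

(* The six transvections, [k] indexing the off-diagonal positions so that
   [elem3 (5 - k) (- s)] is the inverse transpose of [elem3 k s]. *)
Definition elem3 (k : nat) (s : K) : mat3 :=
  match k with
  | 0 => M3 1 s 0 0 1 0 0 0 1
  | 1 => M3 1 0 s 0 1 0 0 0 1
  | 2 => M3 1 0 0 0 1 s 0 0 1
  | 3 => M3 1 0 0 0 1 0 0 s 1
  | 4 => M3 1 0 0 0 1 0 s 0 1
  | _ => M3 1 0 0 s 1 0 0 0 1
  end.

Record vec14 := V14 { vX : vec6; vY : vec6; vxi : K; veta : K }.

Definition cA14 (p q : vec14) : vec6 := add6 (sharp6 (vY p) (vY q))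
  (add6 (scale6 (- vxi p) (vX q)) (scale6 (- vxi q) (vX p))).
Definition cB14 (p q : vec14) : vec6 := add6 (sharp6 (vX p) (vX q))
  (add6 (scale6 (- veta p) (vY q)) (scale6 (- veta q) (vY p))).
Definition cs14 (p q : vec14) : K :=
  dot6 (vX p) (vY q) + dot6 (vX q) (vY p).
Definition cm14 (p q : vec14) : K := vxi p * veta q + vxi q * veta p.

(* [8 (P x Q) R]: the factor 8 makes all coefficients integral. *)
Definition fcross14 (p q r : vec14) : vec14 := V14
  (add6 (add6 (scale6 (-2) (add6 (trip6 (vX p) (vY q) (vX r))
                                 (trip6 (vX q) (vY p) (vX r))))
              (scale6 (cs14 p q + cm14 p q) (vX r)))
        (add6 (scale6 2 (sharp6 (cB14 p q) (vY r)))
              (scale6 (-2 * veta r) (cA14 p q))))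
  (add6 (add6 (scale6 2 (add6 (trip6 (vY q) (vX p) (vY r))
                              (trip6 (vY p) (vX q) (vY r))))
              (scale6 (- (cs14 p q + cm14 p q)) (vY r)))
        (add6 (scale6 (-2) (sharp6 (cA14 p q) (vX r)))
              (scale6 (2 * vxi r) (cB14 p q))))
  (-2 * dot6 (cA14 p q) (vY r) + (cs14 p q - 3 * cm14 p q) * vxi r)
  (2 * dot6 (cB14 p q) (vX r) - (cs14 p q - 3 * cm14 p q) * veta r).

Definition scale14 k (p : vec14) :=
  V14 (scale6 k (vX p)) (scale6 k (vY p)) (k * vxi p) (k * veta p).
Definition add14 (p q : vec14) :=
  V14 (add6 (vX p) (vX q)) (add6 (vY p) (vY q)) (vxi p + vxi q)
      (veta p + veta q).

(** The exponential series of the nilpotent Phi(0, a, 0, 0) ends at the third power: its quadratic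
    terms involve [adj6 a] and its cubic term [det6 a]. *)
Definition tau14 (a : vec6) (p : vec14) := V14
  (add6 (vX p) (scale6 (veta p) a))
  (add6 (vY p) (add6 (sharp6 a (vX p)) (scale6 (veta p) (adj6 a))))
  (vxi p + dot6 a (vY p) + dot6 (adj6 a) (vX p) + veta p * det6 a)
  (veta p).

Definition iota14 (p : vec14) :=
  V14 (scale6 (-1) (vY p)) (vX p) (- veta p) (vxi p).
Definition iotaV14 (p : vec14) :=
  V14 (vY p) (scale6 (-1) (vX p)) (veta p) (- vxi p).

Definition tauV14 (b : vec6) (p : vec14) := V14
  (add6 (vX p) (add6 (sharp6 b (vY p)) (scale6 (vxi p) (adj6 b))))
  (add6 (vY p) (scale6 (vxi p) b))
  (vxi p)
  (veta p + dot6 b (vX p) + dot6 (adj6 b) (vY p) + vxi p * det6 b).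

(** The two summands carry g and g^-T for g = [elem3 k s]. For k >= 5 truncated subtraction gives
    [5 - k] = 0, in accordance with the default case of [elem3]. *)
Definition lev14 k s (p : vec14) : vec14 :=
  V14 (conj6 (elem3 k s) (vX p)) (conj6 (elem3 (5 - k) (- s)) (vY p))
      (vxi p) (veta p).

Definition low1 : vec14 := V14 zero6 zero6 0 1.
Definition up1 : vec14 := V14 zero6 zero6 1 0.
Definition zero14 : vec14 := V14 zero6 zero6 0 0.

Definition inX x : vec14 := V14 x zero6 0 0.
Definition inY y : vec14 := V14 zero6 y 0 0.

End CoordinateOperations.

Arguments zero6 {K}.
Arguments one6 {K}.
Arguments one3 {K}.
Arguments low1 {K}.
Arguments up1 {K}.
Arguments zero14 {K}.
Arguments iota14 {K} p.
Arguments iotaV14 {K} p.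

(** Only the coordinate operations are unfolded; the operations of the field stay folded for [ring]
    and [field]. *)
Ltac coords := lazy beta iota zeta delta
  [v11 v22 v33 v12 v13 v23 add6 scale6 sharp6 adj6 dot6 det6 zero6 one6 trip6
   m11 m12 m13 m21 m22 m23 m31 m32 m33 mul3 one3 det3 row6 conj6 elem3
   vX vY vxi veta cA14 cB14 cs14 cm14 fcross14 scale14 add14 tau14 tauV14
   iota14 iotaV14 lev14 low1 up1 zero14 inX inY].

Ltac case14 := do ?case=> [[? ? ? ? ? ?] [? ? ? ? ? ?] ? ?].

(** * The Jordan algebra and the Freudenthal product in coordinates *)

Section Coordinates.
Variable K : numClosedFieldType.
Local Notation vec6 := (vec6 K).
Local Notation vec14 := (vec14 K).
Local Notation J := (symmx K).

Definition mx6 (x : vec6) : 'M[K]_3 :=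
  \matrix_(i, j) nth 0 (nth [::] [:: [:: v11 x; v12 x; v13 x];
                                     [:: v12 x; v22 x; v23 x];
                                     [:: v13 x; v23 x; v33 x]] i) j.

Lemma ord3_ind (P : 'I_3 -> Prop) :
  P 0 -> P 1 -> P 2%:R -> forall i, P i.
Proof.
move=> P0 P1 P2 [[|[|[|//]]] h].
- by rewrite (_ : Ordinal h = 0) //; exact: val_inj.
- by rewrite (_ : Ordinal h = 1) //; exact: val_inj.
- by rewrite (_ : Ordinal h = 2%:R) //; exact: val_inj.
Qed.

Lemma big_ord3 (F : 'I_3 -> K) : \sum_i F i = F 0 + F 1 + F 2%:R.
Proof.
rewrite !big_ord_recl big_ord0 addr0 addrA.
by congr (_ + F _ + F _); exact: val_inj.
Qed.

Fact mx6_symm x : mx6 x \in @symm K.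
Proof.
by rewrite inE; apply/eqP/matrixP; do 2!elim/ord3_ind; rewrite !mxE.
Qed.

(* Locked: otherwise unification unfolds the operations of [symmx]. *)
Definition sm (x : vec6) : J := locked (SymMx (mx6_symm x)).

Lemma smE x : sm x = SymMx (mx6_symm x).
Proof. by rewrite /sm -lock. Qed.

Definition co6 (X : J) : vec6 :=
  V6 (X 0 0) (X 1 1) (X 2%:R 2%:R) (X 1 2%:R) (X 0 2%:R) (X 0 1).

Lemma co6K : cancel co6 sm.
Proof.
move=> X; rewrite smE; apply/val_inj/matrixP; elim/ord3_ind; elim/ord3_ind;
  rewrite !mxE /= //; exact: symmE.
Qed.

Lemma smK : cancel sm co6.
Proof. by case=> *; rewrite /co6 smE /= !mxE. Qed.

Lemma sm0 : sm zero6 = 0.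
Proof.
by rewrite ?smE; apply/val_inj/matrixP; do 2!elim/ord3_ind; rewrite !mxE.
Qed.

Lemma smD x y : sm x + sm y = sm (add6 x y).
Proof.
by rewrite ?smE; apply/val_inj/matrixP; do 2!elim/ord3_ind; rewrite !mxE.
Qed.

Lemma smZ k x : k *: sm x = sm (scale6 k x).
Proof.
by rewrite ?smE; apply/val_inj/matrixP; do 2!elim/ord3_ind; rewrite !mxE.
Qed.

Lemma smB x y : sm x - sm y = sm (add6 x (scale6 (-1) y)).
Proof. by rewrite -smD -smZ scaleN1r. Qed.

Lemma sm1 : jone K = sm one6.
Proof.
by rewrite ?smE; apply/val_inj/matrixP; do 2!elim/ord3_ind; rewrite !mxE.
Qed.

Lemma tr_sm x : \tr (sm x) = v11 x + v22 x + v33 x.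
Proof. by rewrite smE /mxtrace big_ord3 /= !mxE. Qed.

Lemma jform_sm x y : jform (sm x) (sm y) = dot6 x y.
Proof. by rewrite !smE jformE !big_ord3 /= !mxE /= /dot6; ring. Qed.

Lemma jmul_sm x y : jmul (sm x) (sm y) = sm (scale6 2^-1
  (V6 (2 * (v11 x * v11 y + v12 x * v12 y + v13 x * v13 y))
      (2 * (v12 x * v12 y + v22 x * v22 y + v23 x * v23 y))
      (2 * (v13 x * v13 y + v23 x * v23 y + v33 x * v33 y))
      (v12 x * v13 y + v22 x * v23 y + v23 x * v33 y
       + v13 x * v12 y + v23 x * v22 y + v33 x * v23 y)
      (v11 x * v13 y + v12 x * v23 y + v13 x * v33 y
       + v13 x * v11 y + v23 x * v12 y + v33 x * v13 y)
      (v11 x * v12 y + v12 x * v22 y + v13 x * v23 y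
       + v12 x * v11 y + v22 x * v12 y + v23 x * v13 y))).
Proof.
by rewrite !smE; apply/val_inj/matrixP; do 2!elim/ord3_ind;
  rewrite !mxE !big_ord3 !mxE /=; congr (_ * _); ring.
Qed.

Lemma vec6P (x y : vec6) : v11 x = v11 y -> v22 x = v22 y -> v33 x = v33 y ->
  v23 x = v23 y -> v13 x = v13 y -> v12 x = v12 y -> x = y.
Proof. by case: x y => ? ? ? ? ? ? [? ? ? ? ? ?] /= -> -> -> -> -> ->. Qed.

Lemma jcross_sm x y : 2 *: jcross (sm x) (sm y) = sm (sharp6 x y).
Proof.
rewrite /jcross !tr_sm jform_sm jmul_sm sm1 !smZ !smB !smD !smZ; congr sm.
by case: x y => ? ? ? ? ? ? [? ? ? ? ? ?]; apply: vec6P; coords; field.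
Qed.

Lemma jcrossE x y : jcross (sm x) (sm y) = sm (scale6 2^-1 (sharp6 x y)).
Proof.
by rewrite -smZ -jcross_sm scalerA mulVf ?scale1r.
Qed.

Lemma jvee_sm x w u : jvee (sm x) (sm w) (sm u) =
  sm (add6 (scale6 2^-1 (trip6 x w u)) (scale6 (- (3^-1 * dot6 x w)) u)).
Proof.
rewrite /jvee jform_sm sm1 !(jmul_sm, smZ, smB, smD); congr sm.
case: x w u => ? ? ? ? ? ? [? ? ? ? ? ?] [? ? ? ? ? ?].
by apply: vec6P; coords; field.
Qed.

(** Each X~ is self-adjoint for [jform], so transposition reverses the commutator [X~, W~], and the
    remaining term of [jvee] is self-adjoint and symmetric in X and W. *)
Lemma jform_jvee x w u v :
  jform (jvee (sm x) (sm w) (sm u)) (sm v) =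
  jform (sm u) (jvee (sm w) (sm x) (sm v)).
Proof.
rewrite !jvee_sm !jform_sm.
case: x w u v => ? ? ? ? ? ? [? ? ? ? ? ?] [? ? ? ? ? ?] [? ? ? ? ? ?].
by coords; field.
Qed.

(** Eliminates [jtr] from [fcross], which thereby becomes an explicit polynomial map. *)
Lemma jtr_jvee (X Y Z W : J) :
  jtr (fun V => - 2^-1 *: (jvee X W V + jvee Z Y V)) =
  (fun V => - 2^-1 *: (jvee W X V + jvee Y Z V)).
Proof.
apply/esym/jtr_uniq => [|U V]; first by have [] := fcross_e6 X Y Z W.
rewrite -[X]co6K -[Y]co6K -[Z]co6K -[W]co6K -[U]co6K -[V]co6K.
have D (A B C : J) : jform (- 2^-1 *: (A + B)) C =
   - 2^-1 * (jform A C + jform B C).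
  rewrite -[A]co6K -[B]co6K -[C]co6K smD smZ !jform_sm.
  by coords; ring.
rewrite D [RHS]jformC D jform_jvee jform_jvee.
by congr (_ * (_ + _)); exact: jformC.
Qed.

Definition sf (p : vec14) : freud K := (sm (vX p), sm (vY p), vxi p, veta p).
Definition cof (P : freud K) : vec14 :=
  V14 (co6 P.1.1.1) (co6 P.1.1.2) P.1.2 P.2.

Lemma cofK : cancel cof sf.
Proof. by case=> [[[X Y] xi] eta]; rewrite /sf /= !co6K. Qed.

Lemma sfK : cancel sf cof.
Proof. by case=> X Y xi eta; rewrite /cof /= !smK. Qed.

Lemma sfZ k p : k *: sf p = sf (scale14 k p).
Proof. by rewrite /sf /= -!smZ. Qed.

Lemma sfD p q : sf p + sf q = sf (add14 p q).
Proof. by rewrite /sf /= -!smD. Qed.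

Lemma fcrossE p q r : fcross (sf p) (sf q) (sf r) =
  sf (scale14 8^-1 (fcross14 p q r)).
Proof.
rewrite /fcross /sf /fPhi /= jtr_jvee.
rewrite !jvee_sm.
rewrite !jcrossE.
rewrite !(smZ, smB, smD, jform_sm).
rewrite !jcrossE.
rewrite !(smZ, smB, smD, jform_sm).
case: p q r => [[? ? ? ? ? ?] [? ? ? ? ? ?] ? ?].
case=> [[? ? ? ? ? ?] [? ? ? ? ? ?] ? ?].
case=> [[? ? ? ? ? ?] [? ? ? ? ? ?] ? ?].
congr (_, _, _, _).
- by congr sm; apply: vec6P; coords; field.
- by congr sm; apply: vec6P; coords; field.
- by coords; field.
- by coords; field.
Qed.

End Coordinates.

(** * Translations, their duals and transvections as automorphisms of the product *)

Section Generators.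
Variable K : numClosedFieldType.
Local Notation vec6 := (vec6 K).
Local Notation vec14 := (vec14 K).
Local Notation mat3 := (mat3 K).
Implicit Types (p q r : vec14) (x y w u a b : vec6) (h : mat3) (s : K).

Lemma vec14P (p q : vec14) : vX p = vX q -> vY p = vY q -> vxi p = vxi q ->
  veta p = veta q -> p = q.
Proof. by case: p q => ? ? ? ? [? ? ? ?] /= -> -> -> ->. Qed.

Definition lin14 (f : vec14 -> vec14) :=
  forall k p q, f (add14 (scale14 k p) q) = add14 (scale14 k (f p)) (f q).

Definition aut14 (f : vec14 -> vec14) :=
  forall p q r, f (fcross14 p q r) = fcross14 (f p) (f q) (f r).

Fact fiso14_subproof (f g : vec14 -> vec14) :
  lin14 f -> cancel f g -> cancel g f ->
  `[< linear (@sf K \o f \o @cof K) /\ bijective (@sf K \o f \o @cof K) >].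
Proof.
move=> lf fg gf; apply/asboolP; split=> [k P Q|].
  by rewrite /= -[P]cofK -[Q]cofK !(sfZ, sfD, sfK) lf.
by exists (@sf K \o g \o @cof K) => P /=; rewrite sfK ?fg ?gf cofK.
Qed.

Definition fiso14 f g lf fg gf : fiso K := FIso (@fiso14_subproof f g lf fg gf).

Lemma fiso14E f g lf fg gf p : @fiso14 f g lf fg gf (sf p) = sf (f p).
Proof. by rewrite /= sfK. Qed.

Lemma fisoK (a : fiso K) P : (a^-1)%g (a P) = P.
Proof. by rewrite -[LHS]fisoME mulVg. Qed.

Lemma fisoVK (a : fiso K) P : a ((a^-1)%g P) = P.
Proof. by rewrite -[LHS]fisoME mulgV. Qed.

Lemma E7P (a : fiso K) : E7 K a <->
  forall P Q R, a (fcross P Q R) = fcross (a P) (a Q) (a R).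
Proof.
split=> [Ea P Q R|aP P Q].
  by rewrite -Ea /comp fisoK.
by apply/funext => R; rewrite /comp aP fisoVK.
Qed.

Lemma E7_fiso14 f g lf fg gf : aut14 f -> E7 K (@fiso14 f g lf fg gf).
Proof.
move=> af; apply/E7P => P Q R; rewrite -[P]cofK -[Q]cofK -[R]cofK.
rewrite !fiso14E !fcrossE fiso14E -af.
(* Homogeneity comes from [lin14] with the zero vector, written [scale14 0 (cof P)], as second
   summand; it moves the factor 1/8 through [f]. *)
have := lf 8^-1 (fcross14 (cof P) (cof Q) (cof R)) (scale14 0 (cof P)).
have f0 : f (scale14 0 (cof P)) = scale14 0 (f (cof P)).
  have := lf (-1) (cof P) (cof P).
  have E (q : vec14) : add14 (scale14 (-1) q) q = scale14 0 q.
    by apply: vec14P; try apply: vec6P; coords; ring.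
  by rewrite !E.
have E (p q : vec14) : add14 p (scale14 0 q) = p.
  by apply: vec14P; try apply: vec6P; coords; ring.
by rewrite f0 !E => ->.
Qed.

Lemma tau14_lin a : lin14 (tau14 a).
Proof.
move=> k; case14; apply: vec14P; try apply: vec6P; coords; ring.
Qed.

Lemma tau14D a b p : tau14 a (tau14 b p) = tau14 (add6 a b) p.
Proof.
apply: vec14P; try apply: vec6P; coords; ring.
Qed.

Lemma tau14_0 p : tau14 zero6 p = p.
Proof.
apply: vec14P; try apply: vec6P; coords; ring.
Qed.

Lemma tau14K a : cancel (tau14 a) (tau14 (scale6 (-1) a)).
Proof.
move=> p; rewrite tau14D -[RHS]tau14_0; congr tau14.
by apply: vec6P; coords; ring.
Qed.

Lemma tau14VK a : cancel (tau14 (scale6 (-1) a)) (tau14 a).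
Proof.
move=> p; rewrite tau14D -[RHS]tau14_0; congr tau14.
by apply: vec6P; coords; ring.
Qed.

Lemma iota14K : cancel (@iota14 K) iotaV14.
Proof.
move=> p; apply: vec14P; try apply: vec6P; coords; ring.
Qed.

Lemma iota14VK : cancel (@iotaV14 K) iota14.
Proof.
move=> p; apply: vec14P; try apply: vec6P; coords; ring.
Qed.

Lemma iota14_aut : aut14 (@iota14 K).
Proof.
case14; apply: vec14P; try apply: vec6P; coords; ring.
Qed.

Lemma tauV14E b p : tauV14 b p = iota14 (tau14 (scale6 (-1) b) (iotaV14 p)).
Proof.
apply: vec14P; rewrite /iota14 /iotaV14 /tau14 /tauV14; try apply: vec6P;
  coords; ring.
Qed.

Lemma iotaV14_aut : aut14 (@iotaV14 K).
Proof.
move=> p q r; apply: (can_inj iota14K).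
by rewrite iota14_aut !iota14VK.
Qed.

Lemma tauV14_lin b : lin14 (tauV14 b).
Proof.
move=> k; case14; apply: vec14P; try apply: vec6P; coords; ring.
Qed.

Lemma tauV14D a b p : tauV14 a (tauV14 b p) = tauV14 (add6 a b) p.
Proof.
apply: vec14P; try apply: vec6P; coords; ring.
Qed.

Lemma tauV14_0 p : tauV14 zero6 p = p.
Proof.
apply: vec14P; try apply: vec6P; coords; ring.
Qed.

Lemma tauV14K a : cancel (tauV14 a) (tauV14 (scale6 (-1) a)).
Proof.
move=> p; rewrite tauV14D -[RHS]tauV14_0; congr tauV14.
by apply: vec6P; coords; ring.
Qed.

Lemma tauV14VK a : cancel (tauV14 (scale6 (-1) a)) (tauV14 a).
Proof.
move=> p; rewrite tauV14D -[RHS]tauV14_0; congr tauV14.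
by apply: vec6P; coords; ring.
Qed.

Lemma conj6M (g h : mat3) x : conj6 (mul3 g h) x = conj6 g (conj6 h x).
Proof. by apply: vec6P; coords; ring. Qed.

Lemma conj6_1 x : conj6 one3 x = x.
Proof. by apply: vec6P; coords; ring. Qed.

Lemma conj6_lin (g : mat3) k x y :
  conj6 g (add6 (scale6 k x) y) = add6 (scale6 k (conj6 g x)) (conj6 g y).
Proof. by apply: vec6P; coords; ring. Qed.

Lemma mat3P (g h : mat3) : m11 g = m11 h -> m12 g = m12 h -> m13 g = m13 h ->
  m21 g = m21 h -> m22 g = m22 h -> m23 g = m23 h ->
  m31 g = m31 h -> m32 g = m32 h -> m33 g = m33 h -> g = h.
Proof.
case: g h => ? ? ? ? ? ? ? ? ? [? ? ? ? ? ? ? ? ?] /=.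
by move=> -> -> -> -> -> -> -> -> ->.
Qed.

Lemma elem3K k s : mul3 (elem3 k (- s)) (elem3 k s) = one3.
Proof.
by case: k => [|[|[|[|[|k]]]]]; apply: mat3P; coords; ring.
Qed.

Lemma lev14_lin k s : lin14 (lev14 k s).
Proof.
move=> a p q; apply: vec14P => //=; exact: conj6_lin.
Qed.

Lemma lev14K k s : cancel (lev14 k s) (lev14 k (- s)).
Proof.
move=> p; apply: vec14P => //=; rewrite -conj6M.
  by rewrite elem3K conj6_1.
by rewrite elem3K conj6_1.
Qed.

Lemma lev14VK k s : cancel (lev14 k (- s)) (lev14 k s).
Proof. by move=> p; rewrite -{1}[s]opprK lev14K. Qed.

Lemma conj6D (g : mat3) x y : conj6 g (add6 x y) = add6 (conj6 g x) (conj6 g y).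
Proof. by apply: vec6P; coords; ring. Qed.

Lemma conj6Z (g : mat3) k x : conj6 g (scale6 k x) = scale6 k (conj6 g x).
Proof. by apply: vec6P; coords; ring. Qed.

(** Writing the inverse transpose as another transvection keeps this and the next two identities
    polynomial in s, so that [ring] decides them without division. *)
Lemma trip6_elem k s x w u :
  trip6 (conj6 (elem3 k s) x) (conj6 (elem3 (5 - k) (- s)) w)
        (conj6 (elem3 k s) u) = conj6 (elem3 k s) (trip6 x w u).
Proof.
case: k => [|[|[|[|[|[|k]]]]]] /=;
  by apply: vec6P; coords; ring.
Qed.

Lemma sharp6_elem k s x y :
  sharp6 (conj6 (elem3 k s) x) (conj6 (elem3 k s) y) =
  conj6 (elem3 (5 - k) (- s)) (sharp6 x y).
Proof.
case: k => [|[|[|[|[|[|k]]]]]] /=;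
  by apply: vec6P; coords; ring.
Qed.

Lemma dot6_elem k s x y :
  dot6 (conj6 (elem3 k s) x) (conj6 (elem3 (5 - k) (- s)) y) = dot6 x y.
Proof. by case: k => [|[|[|[|[|[|k]]]]]]; rewrite /elem3 /=; coords; ring. Qed.

Lemma elem3_dual k s : elem3 (5 - (5 - k)) (- - s) = elem3 k s.
Proof. by rewrite opprK; case: k => [|[|[|[|[|[|k]]]]]]. Qed.

Lemma trip6_elemV k s x w u :
  trip6 (conj6 (elem3 (5 - k) (- s)) x) (conj6 (elem3 k s) w)
        (conj6 (elem3 (5 - k) (- s)) u)
  = conj6 (elem3 (5 - k) (- s)) (trip6 x w u).
Proof. by rewrite -[elem3 k s]elem3_dual trip6_elem. Qed.

Lemma sharp6_elemV k s x y :
  sharp6 (conj6 (elem3 (5 - k) (- s)) x) (conj6 (elem3 (5 - k) (- s)) y) =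
  conj6 (elem3 k s) (sharp6 x y).
Proof. by rewrite -[elem3 k s]elem3_dual sharp6_elem. Qed.

Lemma dot6C (x y : vec6) : dot6 x y = dot6 y x.
Proof. by coords; ring. Qed.

Lemma dot6_elemV k s x y :
  dot6 (conj6 (elem3 (5 - k) (- s)) x) (conj6 (elem3 k s) y) = dot6 x y.
Proof. by rewrite dot6C dot6_elem dot6C. Qed.

(** [fcross14] is built from [trip6], [sharp6] and [dot6], with [cA14] transforming like the first
    summand and [cB14] like the second, so equivariance holds term by term. *)
Lemma lev14_aut k s : aut14 (lev14 k s).
Proof.
move=> p q r.
have EA : cA14 (lev14 k s p) (lev14 k s q) = conj6 (elem3 k s) (cA14 p q).
  by rewrite /cA14; cbn [lev14 vX vY vxi veta];
     rewrite sharp6_elemV -!conj6Z -!conj6D.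
have EB : cB14 (lev14 k s p) (lev14 k s q) =
    conj6 (elem3 (5 - k) (- s)) (cB14 p q).
  by rewrite /cB14; cbn [lev14 vX vY vxi veta];
     rewrite sharp6_elem -!conj6Z -!conj6D.
have Es : cs14 (lev14 k s p) (lev14 k s q) = cs14 p q.
  by rewrite /cs14; cbn [lev14 vX vY vxi veta]; rewrite !dot6_elem.
rewrite /fcross14 EA EB Es.
rewrite [lev14 k s (V14 _ _ _ _)]/lev14 /cm14; cbn [lev14 vX vY vxi veta].
rewrite !(trip6_elem k s) !(trip6_elemV k s).
rewrite (sharp6_elem k s) (sharp6_elemV k s).
by rewrite (dot6_elem k s) (dot6_elemV k s) !(conj6D, conj6Z).
Qed.

Lemma adj6E (a : vec6) : sharp6 a a = scale6 2 (adj6 a).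
Proof. by apply: vec6P; coords; ring. Qed.

Lemma scale6_inj k (x y : vec6) : k != 0 -> scale6 k x = scale6 k y -> x = y.
Proof.
move=> k0; case: x y => ? ? ? ? ? ? [? ? ? ? ? ?] [].
by do 6!move/(mulfI k0)=> ->.
Qed.

Lemma adj6_elem k s a :
  adj6 (conj6 (elem3 k s) a) = conj6 (elem3 (5 - k) (- s)) (adj6 a).
Proof.
have n2 : (2 : K) != 0 by [].
by apply: (scale6_inj n2); rewrite -conj6Z -!adj6E sharp6_elem.
Qed.

Lemma det6E (a : vec6) : 3 * det6 a = dot6 a (adj6 a).
Proof. by coords; ring. Qed.

Lemma det6_elem k s a : det6 (conj6 (elem3 k s) a) = det6 a.
Proof.
have n3 : (3 : K) != 0 by [].
by apply: (mulfI n3); rewrite !det6E adj6_elem dot6_elem.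
Qed.

Lemma lev14_tau14 k s a p :
  lev14 k s (tau14 a p) = tau14 (conj6 (elem3 k s) a) (lev14 k s p).
Proof.
rewrite /tau14 [in LHS]/lev14; cbn [lev14 vX vY vxi veta].
rewrite adj6_elem (sharp6_elem k s) det6_elem (dot6_elem k s).
by rewrite (dot6_elemV k s) !(conj6D, conj6Z).
Qed.

Lemma tau14_aut_conj k s a :
  aut14 (tau14 a) -> aut14 (tau14 (conj6 (elem3 k s) a)).
Proof.
have E p : tau14 (conj6 (elem3 k s) a) p =
    lev14 k s (tau14 a (lev14 k (- s) p)).
  by rewrite lev14_tau14 lev14VK.
by move=> h p q r; rewrite !E lev14_aut h lev14_aut.
Qed.

Lemma tau14_aut_add a b :
  aut14 (tau14 a) -> aut14 (tau14 b) -> aut14 (tau14 (add6 a b)).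
Proof. by move=> ha hb p q r; rewrite -!tau14D hb ha. Qed.

(** The only translations checked by direct expansion; [tau14_aut] derives all others from them. *)
Lemma tau14_aut11 t : aut14 (tau14 (V6 t 0 0 0 0 0)).
Proof.
by case14; apply: vec14P; try apply: vec6P; coords; ring.
Qed.

(* Rank one matrices t(e_i + e_j)(e_i + e_j)^T span the symmetric matrices and
   are conjugate to t E_11 under transvections. *)
Lemma tau14_aut a : aut14 (tau14 a).
Proof.
have h11 := tau14_aut11.
have C k s (b c : vec6) : conj6 (elem3 k s) b = c ->
  aut14 (tau14 b) -> aut14 (tau14 c).
  by move=> <-; exact: tau14_aut_conj.
have h12 t : aut14 (tau14 (V6 t t 0 0 0 t)).
  by apply: (C 5%N 1) (h11 t); apply: vec6P; coords; ring.
have h13 t : aut14 (tau14 (V6 t 0 t 0 t 0)).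
  by apply: (C 4%N 1) (h11 t); apply: vec6P; coords; ring.
have h22 t : aut14 (tau14 (V6 0 t 0 0 0 0)).
  by apply: (C 0%N (-1)) (h12 t); apply: vec6P; coords; ring.
have h33 t : aut14 (tau14 (V6 0 0 t 0 0 0)).
  by apply: (C 1%N (-1)) (h13 t); apply: vec6P; coords; ring.
have h23 t : aut14 (tau14 (V6 0 t t t 0 0)).
  by apply: (C 3%N 1) (h22 t); apply: vec6P; coords; ring.
have -> : a = add6 (V6 (v11 a - v12 a - v13 a) 0 0 0 0 0)
   (add6 (V6 0 (v22 a - v12 a - v23 a) 0 0 0 0)
   (add6 (V6 0 0 (v33 a - v13 a - v23 a) 0 0 0)
   (add6 (V6 0 (v23 a) (v23 a) (v23 a) 0 0)
   (add6 (V6 (v13 a) 0 (v13 a) 0 (v13 a) 0)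
   (V6 (v12 a) (v12 a) 0 0 0 (v12 a)))))).
  by apply: vec6P; coords; ring.
by do 5?apply: tau14_aut_add.
Qed.

Lemma tauV14_aut a : aut14 (tauV14 a).
Proof.
by move=> p q r; rewrite !tauV14E iotaV14_aut tau14_aut iota14_aut.
Qed.

End Generators.

(** * The generated subgroup and its transitivity on M *)

Section Generated.
Variable K : numClosedFieldType.
Local Notation vec6 := (vec6 K).
Local Notation vec14 := (vec14 K).
Local Notation fiso := (fiso K).

Definition tau a : fiso := fiso14 (tau14_lin a) (tau14K a) (tau14VK a).
Definition tauV a : fiso := fiso14 (tauV14_lin a) (tauV14K a) (tauV14VK a).
Definition lev k s : fiso :=
  fiso14 (lev14_lin k s) (lev14K k s) (lev14VK k s).

Lemma tauE a p : tau a (sf p) = sf (tau14 a p). Proof. exact: fiso14E. Qed.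
Lemma tauVE a p : tauV a (sf p) = sf (tauV14 a p). Proof. exact: fiso14E. Qed.
Lemma levE k s p : lev k s (sf p) = sf (lev14 k s p).
Proof. exact: fiso14E. Qed.

(** Whole families rather than single elements are recorded: the parameter 0 gives the identity, so
    every generator comes with a path to it. *)
Variant oneparam : (K -> fiso) -> Prop :=
| Oneparam_tau a : oneparam (fun t => tau (scale6 t a))
| Oneparam_tauV a : oneparam (fun t => tauV (scale6 t a))
| Oneparam_lev k : oneparam (lev k).

(** Words in the generators, extended on the left. Closure under inverses follows from [oneparamV],
    since u(-t) is again a generator. *)
Inductive gen : fiso -> Prop :=
| Gen1 : gen 1%g
| GenM u t a : oneparam u -> gen a -> gen (u t * a)%g.

Lemma fisoP14 (a b : fiso) : (forall p, a (sf p) = b (sf p)) -> a = b.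
Proof.
by move=> ab; apply/val_inj/funext => P; rewrite -[P]cofK; exact: ab.
Qed.

Lemma fiso1E P : (1%g : fiso) P = P. Proof. by []. Qed.

Lemma oneparam_E7 u t : oneparam u -> E7 K (u t).
Proof.
case=> [a|a|k]; apply: E7_fiso14;
  [exact: tau14_aut|exact: tauV14_aut|exact: lev14_aut].
Qed.

Lemma scale6_0 (a : vec6) : scale6 0 a = zero6.
Proof. by apply: vec6P; coords; ring. Qed.

Lemma scale6_1 (a : vec6) : scale6 1 a = a.
Proof. by apply: vec6P; coords; ring. Qed.

Lemma lev14_0 k p : lev14 k 0 p = p :> vec14.
Proof.
have E i : elem3 i 0 = one3 by case: i => [|[|[|[|[|i]]]]].
by apply: vec14P; rewrite /lev14 ?oppr0 ?E /= ?conj6_1.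
Qed.

Lemma oneparam0 u : oneparam u -> u 0 = 1%g.
Proof.
by case=> [a|a|k]; apply: fisoP14 => p;
  rewrite ?tauE ?tauVE ?levE ?scale6_0 ?tau14_0 ?tauV14_0 ?lev14_0.
Qed.

Lemma oneparamN u t : oneparam u -> (u t * u (- t) = 1)%g.
Proof.
have N a : scale6 t a = scale6 (-1) (scale6 (- t) a).
  by apply: vec6P; coords; ring.
case=> [a|a|k]; apply: fisoP14 => p; rewrite [LHS]fisoME fiso1E.
- by rewrite !tauE N tau14K.
- by rewrite !tauVE N tauV14K.
- by rewrite !levE lev14VK.
Qed.

Lemma oneparamV u t : oneparam u -> ((u t)^-1 = u (- t))%g.
Proof.
move=> hu; rewrite -[RHS]mul1g -[in RHS](mulVg (u t)) -mulgA.
by rewrite oneparamN ?mulg1.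
Qed.

Lemma gen_E7 a : gen a -> E7 K a.
Proof.
elim=> [|u t b hu _ Eb]; first exact: E7_1.
by apply: E7M => //; exact: oneparam_E7.
Qed.

Lemma genMg a b : gen a -> gen b -> gen (a * b)%g.
Proof.
elim=> [|u t c hu _ IH] gb; first by rewrite mul1g.
by rewrite -mulgA; apply: GenM => //; exact: IH.
Qed.

Lemma gen_oneparam u t : oneparam u -> gen (u t).
Proof. by move=> hu; rewrite -[u t]mulg1; apply: GenM => //; exact: Gen1. Qed.

Lemma genV a : gen a -> gen (a^-1)%g.
Proof.
elim=> [|u t b hu _ IH]; first by rewrite invg1; exact: Gen1.
by rewrite invgM (oneparamV t hu); apply: genMg => //; exact: gen_oneparam.
Qed.

Lemma gen_tau a : gen (tau a).
Proof.
by rewrite -[a]scale6_1; apply: (gen_oneparam _ (Oneparam_tau a)).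
Qed.

Lemma gen_tauV a : gen (tauV a).
Proof.
by rewrite -[a]scale6_1; apply: (gen_oneparam _ (Oneparam_tauV a)).
Qed.

Lemma gen_lev k s : gen (lev k s).
Proof. exact: (gen_oneparam _ (Oneparam_lev k)). Qed.

Lemma sf_low1 : sf low1 = dot1 K.
Proof. by rewrite /sf /= sm0. Qed.

Lemma sf0 : sf zero14 = 0 :> freud K.
Proof. by rewrite /sf /= sm0. Qed.

Lemma sf_inj : injective (@sf K).
Proof. exact: can_inj (@sfK K). Qed.

Definition M14 (p : vec14) : Prop :=
  (forall r, fcross14 p p r = zero14) /\ p <> zero14.

Lemma scale14_inj (k : K) (p q : vec14) :
  k != 0 -> scale14 k p = scale14 k q -> p = q.
Proof.
move=> k0 h; apply: vec14P.
- exact: (scale6_inj k0 (congr1 (@vX K) h)).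
- exact: (scale6_inj k0 (congr1 (@vY K) h)).
- exact: (mulfI k0 (congr1 (@vxi K) h)).
- exact: (mulfI k0 (congr1 (@veta K) h)).
Qed.

Lemma scale14_0 (k : K) : scale14 k zero14 = zero14.
Proof. by rewrite /scale14 /scale6 /= mulr0. Qed.

Lemma fM_sf p : fM K (sf p) <-> M14 p.
Proof.
have n8 : (8 : K)^-1 != 0 by rewrite invr_eq0.
split=> [[pp0 p0]|[pp0 p0]]; split.
- move=> r; apply: (scale14_inj n8); apply: sf_inj; rewrite -fcrossE pp0.
  by rewrite scale14_0 sf0.
- by move=> E; apply: p0; rewrite E sf0.
- apply/funext => R; rewrite -[R]cofK fcrossE pp0.
  by rewrite scale14_0 sf0.
- by rewrite -sf0 => /sf_inj.
Qed.

Lemma E7_fM (a : fiso) P : E7 K a -> fM K P -> fM K (a P).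
Proof.
have a0 (b : fiso) : b 0 = 0.
  have [lb _] := fisoP b.
  by have := lb (-1) 0 0; rewrite scaler0 addr0 scaleN1r addNr.
move=> Ea [PP0 P0]; split=> [|aP0].
  by rewrite -Ea PP0; apply/funext => R; rewrite /comp a0.
by apply: P0; rewrite -[P](fisoK a) aP0 a0.
Qed.

(** Evaluating P x P = Phi(phi, A, B, nu) at (0, 0, 0, 1) reads off A, and at (0, 0, 1, 0) it reads
    off B and nu; the three equations are A = 0, B = 0 and nu = 0. *)
Lemma M14_eqs p : M14 p -> [/\ adj6 (vY p) = scale6 (vxi p) (vX p),
  adj6 (vX p) = scale6 (veta p) (vY p) &
  dot6 (vX p) (vY p) = 3 * (vxi p * veta p)].
Proof.
have n2 : (2 : K) != 0 by [].
have n4 : (-4 : K) != 0 by rewrite oppr_eq0.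
have n4' : (4 : K) != 0 by [].
case=> h _.
have h1 := h low1; have h2 := h up1.
split.
- apply: (scale6_inj n4).
  have -> : scale6 (-4) (adj6 (vY p)) =
      add6 (vX (fcross14 p p low1)) (scale6 (-4) (scale6 (vxi p) (vX p))).
    by apply: vec6P; coords; ring.
  by rewrite h1; apply: vec6P; coords; ring.
- apply: (scale6_inj n4').
  have -> : scale6 4 (adj6 (vX p)) =
      add6 (vY (fcross14 p p up1)) (scale6 4 (scale6 (veta p) (vY p))).
    by apply: vec6P; coords; ring.
  by rewrite h2; apply: vec6P; coords; ring.
- apply: (mulfI n2).
  have -> : 2 * dot6 (vX p) (vY p) =
      vxi (fcross14 p p up1) + 6 * (vxi p * veta p) by coords; ring.
  by rewrite h2; coords; ring.
Qed.

Definition E11 (t : K) : vec6 := V6 t 0 0 0 0 0.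

(* On the open set [veta p != 0] this is a section of the orbit map
   [a |-> a dot1]. *)
Definition sect (p : vec14) : fiso :=
  (tau (scale6 (veta p)^-1 (add6 (vX p) (scale6 (-1) (E11 1)))) *
   (tauV (E11 (veta p - 1)) * tau (E11 1)))%g.

Lemma gen_sect p : gen (sect p).
Proof.
by apply: genMg (gen_tau _) _; apply: genMg (gen_tauV _) (gen_tau _).
Qed.

(** The factors of [sect p] carry (0, 0, 0, 1) first to (E_11, 0, 0, 1), then to (E_11, 0, 0, eta),
    then to a point with the same X and eta as p. The other two coordinates agree because Y = adj X
    / eta and xi = det X / eta^2 on M. *)
Lemma sect_low1 p : M14 p -> veta p != 0 -> sect p (sf low1) = sf p.
Proof.
move=> /M14_eqs [_ hx hxy] e0.
have e2 : 3 * veta p ^+ 2 != 0 by rewrite mulf_neq0 // expf_neq0.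
(* 3 det X = (X, adj X) = eta (X, Y) = 3 eta^2 xi. *)
have xiE : veta p ^+ 2 * vxi p = det6 (vX p).
  have n3 : (3 : K) != 0 by [].
  apply: (mulfI n3); rewrite det6E hx.
  have -> : dot6 (vX p) (scale6 (veta p) (vY p)) = veta p * dot6 (vX p) (vY p).
    by coords; ring.
  by rewrite hxy; ring.
have yE : vY p = scale6 (veta p)^-1 (adj6 (vX p)).
  by rewrite hx; apply: vec6P; coords; field.
have {}xiE : vxi p = (veta p)^-1 ^+ 2 * det6 (vX p).
  by rewrite -xiE mulrA -exprMn mulVf // expr1n mul1r.
case: p e0 e2 hx hxy xiE yE => x y xi eta; rewrite /sect.
cbn [vX vY vxi veta]; rewrite !fisoME => e0 _ _ _ -> ->.
rewrite tauE tauVE tauE; congr sf.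
case: x => ? ? ? ? ? ?; apply: vec14P; try apply: vec6P;
  by rewrite /E11; coords; field.
Qed.

(** The last coordinate of [tauV14 b p] is the polynomial eta + (b, X) + (adj b, Y) + xi det b in b.
    If it vanishes for all b, suitable values of b show one after the other that all coordinates of
    p are zero. *)
Lemma quad_nonzero (p : vec14) : p <> zero14 ->
  exists b, veta (tauV14 b p) != 0.
Proof.
move=> p0; apply: contra_notP p0 => /forallNP h.
have {}h b : veta (tauV14 b p) = 0 by apply/eqP/negPn/negP/h.
case: p h => [[x11 x22 x33 x23 x13 x12] [y11 y22 y33 y23 y13 y12] xi eta] h.
have {}h b : eta + dot6 b (V6 x11 x22 x33 x23 x13 x12) +
   dot6 (adj6 b) (V6 y11 y22 y33 y23 y13 y12) + xi * det6 b = 0 := h b.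
have h0 : eta = 0 by rewrite -(h zero6); coords; ring.
have h1 : x11 = 0 by rewrite -(h (V6 1 0 0 0 0 0)) h0; coords; ring.
have h2 : x22 = 0 by rewrite -(h (V6 0 1 0 0 0 0)) h0; coords; ring.
have h3 : x33 = 0 by rewrite -(h (V6 0 0 1 0 0 0)) h0; coords; ring.
have h4 : y11 = 0 by rewrite -(h (V6 0 1 1 0 0 0)) h0 h2 h3; coords; ring.
have h5 : y22 = 0 by rewrite -(h (V6 1 0 1 0 0 0)) h0 h1 h3; coords; ring.
have h6 : y33 = 0 by rewrite -(h (V6 1 1 0 0 0 0)) h0 h2 h1; coords; ring.
have n2 : (2 : K) != 0 by [].
have h7 : x23 = 0.
  by apply: (mulfI n2); rewrite mulr0 -(h (V6 0 0 0 1 0 0)) h0 h4; coords; ring.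
have h8 : x13 = 0.
  by apply: (mulfI n2); rewrite mulr0 -(h (V6 0 0 0 0 1 0)) h0 h5; coords; ring.
have h9 : x12 = 0.
  by apply: (mulfI n2); rewrite mulr0 -(h (V6 0 0 0 0 0 1)) h0 h6; coords; ring.
(* For b with b_33 = 1 and b_12 = 1 or -1, the (1,2) entry of adj b changes sign with b_12 while det
   b = -1 does not; the two values separate y12 from xi. *)
have hA : 2 * y12 + xi = 0.
  rewrite -[LHS]opprK -oppr0; congr (- _).
  rewrite -(h (V6 0 0 1 0 0 1)) h0 h3 h4 h5 h6 h9; coords; ring.
have hA' : 2 * y12 - xi = 0.
  rewrite -(h (V6 0 0 1 0 0 (-1))) h0 h3 h4 h5 h6 h9; coords; ring.
have hx : xi = 0.
  apply: (mulfI n2); rewrite mulr0 -[RHS](subrr (2 * y12 + xi)) {2}hA -hA'.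
  by ring.
have hB : y12 = 0.
  by apply: (mulfI n2); rewrite mulr0 -hA hx addr0.
have hC : y13 = 0.
  apply: (mulfI n2); rewrite mulr0 -(h (V6 0 (-1) 0 0 1 0)).
  by rewrite h0 h2 h4 h5 h6 h8 hx; coords; ring.
have hD : y23 = 0.
  apply: (mulfI n2); rewrite mulr0 -(h (V6 (-1) 0 0 1 0 0)).
  by rewrite h0 h1 h4 h5 h6 h7 hx; coords; ring.
by rewrite /zero14 /zero6 hx hB hC hD h0 h1 h2 h3 h4 h5 h6 h7 h8 h9.
Qed.

Lemma gen_trans P : fM K P -> exists2 a, gen a & a (dot1 K) = P.
Proof.
move=> hP; have := hP; rewrite -{1}[P]cofK => /fM_sf [_ /quad_nonzero [b hb]].
have hM : M14 (tauV14 b (cof P)).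
  by apply/fM_sf; rewrite -tauVE cofK; apply: E7_fM hP; exact/gen_E7/gen_tauV.
exists ((tauV b)^-1 * sect (tauV14 b (cof P)))%g.
  exact: genMg (genV (gen_tauV _)) (gen_sect _).
by rewrite fisoME -sf_low1 sect_low1 // -tauVE fisoK cofK.
Qed.

End Generated.

(** * Generation of SL_3 by transvections *)

Section Transvections.
Variable K : numClosedFieldType.
Local Notation vec6 := (vec6 K).
Local Notation vec14 := (vec14 K).
Local Notation mat3 := (mat3 K).
Local Notation fiso := (fiso K).

Lemma mat3_eta (g : mat3) : g = M3 (m11 g) (m12 g) (m13 g)
  (m21 g) (m22 g) (m23 g) (m31 g) (m32 g) (m33 g).
Proof. by case: g. Qed.

Lemma det3_elem k s (g : mat3) : det3 (mul3 (elem3 k s) g) = det3 g.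
Proof. by case: k => [|[|[|[|[|k]]]]]; coords; ring. Qed.

Lemma mulA3 (f g h : mat3) : mul3 f (mul3 g h) = mul3 (mul3 f g) h.
Proof. by apply: mat3P; coords; ring. Qed.

Lemma mul1_3 (g : mat3) : mul3 one3 g = g.
Proof. by apply: mat3P; coords; ring. Qed.

Section RowReduction.
Variable P : mat3 -> Prop.
Hypothesis P_elem : forall k s g, P (mul3 (elem3 k s) g) -> P g.
Hypothesis P_one : P one3.

(** Once the first two columns are those of the identity, the last pivot equals the determinant,
    hence 1. *)
Lemma row_reduction3 g : m11 g = 1 -> m21 g = 0 -> m31 g = 0 ->
  m12 g = 0 -> m22 g = 1 -> m32 g = 0 -> det3 g = 1 -> P g.
Proof.
rewrite [det3 g]/det3 [X in _ -> P X]mat3_eta => -> -> -> -> -> -> h.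
have {h} -> : m33 g = 1 by rewrite -h; ring.
apply: (P_elem (k := 1) (s := - m13 g)).
apply: (P_elem (k := 2) (s := - m23 g)).
by congr P: P_one; apply: mat3P; coords; ring.
Qed.

Lemma row_reduction2 g : m11 g = 1 -> m21 g = 0 -> m31 g = 0 ->
  det3 g = 1 -> P g.
Proof.
have y1 h : m11 h = 1 -> m21 h = 0 -> m31 h = 0 -> m22 h = 1 ->
    det3 h = 1 -> P h.
  move=> h11 h21 h31 h22 dh.
  apply: (P_elem (k := 3) (s := - m32 h)).
  apply: (P_elem (k := 0) (s := - m12 h)).
  by apply: row_reduction3; rewrite ?det3_elem // /mul3 /elem3 /=
    ?(h11, h21, h31, h22); ring.
have z0 h : m32 h != 0 -> m11 h = 1 -> m21 h = 0 -> m31 h = 0 ->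
    det3 h = 1 -> P h.
  move=> zn0 h11 h21 h31 dh.
  apply: (P_elem (k := 2) (s := (1 - m22 h) / m32 h)).
  by apply: y1; rewrite ?det3_elem // /mul3 /elem3 /= ?(h11, h21, h31); field.
move=> g11 g21 g31 dg; have [E|] := eqVneq (m32 g) 0; last by move/z0; apply.
(* With m32 = 0 the determinant forces m22 to be nonzero, and adding row 2 to row 3 makes m32
   nonzero. *)
have n22 : m22 g != 0.
  apply: contra_eq_neq dg => y0.
  have -> : det3 g = 0 by rewrite /det3 g11 g21 g31 E y0; ring.
  by rewrite eq_sym oner_neq0.
apply: (P_elem (k := 3) (s := 1)); apply: z0; rewrite ?det3_elem //.
- by have -> : m32 (mul3 (elem3 3 1) g) = m22 g by rewrite /= E; ring.
- by rewrite /= g11 g21 g31; ring.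
- by rewrite /= g21; ring.
- by rewrite /= g21 g31; ring.
Qed.

(** Row scalings are not transvections, so the pivot 1 is produced by adding to the first row a
    multiple of a second row whose first entry is nonzero. *)
Lemma row_reduction g : det3 g = 1 -> P g.
Proof.
have y1 h : m11 h = 1 -> det3 h = 1 -> P h.
  move=> h11 dh.
  apply: (P_elem (k := 5) (s := - m21 h)).
  apply: (P_elem (k := 4) (s := - m31 h)).
  by apply: row_reduction2; rewrite ?det3_elem // /mul3 /elem3 /= ?h11; ring.
have z0 h : m21 h != 0 -> det3 h = 1 -> P h.
  move=> zn0 dh.
  apply: (P_elem (k := 0) (s := (1 - m11 h) / m21 h)).
  by apply: y1; rewrite ?det3_elem // /mul3 /elem3 /=; field.
move=> dg; have [E|] := eqVneq (m21 g) 0; last by move/z0; apply.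
(* A nonzero entry is brought to position (2,1) by adding row 1 or, if m11 = 0 too, row 3, whose
   first entry is then nonzero by the determinant. *)
have [E1|n11] := eqVneq (m11 g) 0; last first.
  apply: (P_elem (k := 5) (s := 1)); apply: z0; rewrite ?det3_elem //.
  by have -> : m21 (mul3 (elem3 5 1) g) = m11 g by rewrite /= E; ring.
have n31 : m31 g != 0.
  apply: contra_eq_neq dg => y0.
  have -> : det3 g = 0 by rewrite /det3 E E1 y0; ring.
  by rewrite eq_sym oner_neq0.
apply: (P_elem (k := 2) (s := 1)); apply: z0; rewrite ?det3_elem //.
by have -> : m21 (mul3 (elem3 2 1) g) = m31 g by rewrite /= E; ring.
Qed.

End RowReduction.

(** For elements of [E7] these data also determine the action on the second summand, by the duality
    [phi_psi_dot] below. *)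
Definition acts_by (b : fiso) (g : mat3) :=
  [/\ b (sf low1) = sf low1, b (sf up1) = sf up1 &
      forall x, b (sf (inX x)) = sf (inX (conj6 g x))].

Lemma gen_sl3 g : det3 g = 1 -> exists2 b, gen b & acts_by b g.
Proof.
pose P (g : mat3) := exists2 b, gen b & acts_by b g.
have c0 (h : mat3) : conj6 h zero6 = zero6.
  by apply: vec6P; coords; ring.
apply: (@row_reduction P) => [k s h [b gb [b1 bu bX]]|]; last first.
  by exists 1%g; [exact: Gen1|split=> // x; rewrite conj6_1].
exists (lev k (- s) * b)%g; first exact: genMg (gen_lev _ _) gb.
split=> [||x]; rewrite fisoME ?b1 ?bu ?bX levE /lev14;
  cbn [vX vY vxi veta low1 up1 inX]; rewrite ?c0 //.
by rewrite -conj6M mulA3 elem3K mul1_3.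
Qed.

End Transvections.

(** * Automorphisms fixing (0, 0, 0, 1) and (0, 0, 1, 0) *)

Section Frame.
Variable K : numClosedFieldType.
Local Notation vec6 := (vec6 K).
Local Notation vec14 := (vec14 K).

Lemma lin14D f (p q : vec14) : lin14 f -> f (add14 p q) = add14 (f p) (f q).
Proof.
have E (r : vec14) : scale14 1 r = r.
  by apply: vec14P; try apply: vec6P; coords; ring.
by move=> lf; have := lf 1 p q; rewrite !E.
Qed.

Lemma lin14_0 (f : vec14 -> vec14) : lin14 f -> f zero14 = zero14.
Proof.
move=> lf; have := lf (-1) zero14 zero14.
rewrite scale14_0 (_ : add14 zero14 zero14 = zero14) => [->|].
  by apply: vec14P; try apply: vec6P; coords; ring.
by apply: vec14P; try apply: vec6P; coords; ring.
Qed.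

Lemma lin14Z f k (p : vec14) : lin14 f -> f (scale14 k p) = scale14 k (f p).
Proof.
have E (r : vec14) : add14 r zero14 = r.
  by apply: vec14P; try apply: vec6P; coords; ring.
by move=> lf; rewrite -[scale14 k p]E lf lin14_0 // E.
Qed.

Variable f : vec14 -> vec14.
Hypotheses (f_lin : lin14 f) (f_aut : aut14 f) (f_low1 : f low1 = low1)
  (f_up1 : f up1 = up1).

Definition phi x := vX (f (inX x)).
Definition psi y := vY (f (inY y)).

Lemma eq_scale0 (c x : K) : c != 1 -> x = c * x -> x = 0.
Proof.
move=> c1 /eqP; rewrite -subr_eq0 -{1}[x]mul1r -mulrBl mulf_eq0 subr_eq0.
by rewrite eq_sym (negPf c1) => /eqP.
Qed.

Lemma neq1_N1_3_N3 : [/\ (-1 : K) != 1, (3 : K) != 1 & (-3 : K) != 1].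
Proof.
split; rewrite -subr_eq0.
- by rewrite (_ : -1 - 1 = - 2 :> K) ?oppr_eq0 ?pnatr_eq0 //; ring.
- by rewrite (_ : 3 - 1 = 2 :> K) ?pnatr_eq0 //; ring.
- by rewrite (_ : -3 - 1 = - 4 :> K) ?oppr_eq0 ?pnatr_eq0 //; ring.
Qed.

(* [8 (up1 x low1)] acts on the four summands with distinct eigenvalues. *)
Lemma fcross14_up1_low1 (p : vec14) : fcross14 up1 low1 p =
  V14 (vX p) (scale6 (-1) (vY p)) (-3 * vxi p) (3 * veta p).
Proof. by apply: vec14P; try apply: vec6P; coords; ring. Qed.

Lemma f_eigen p : fcross14 up1 low1 (f p) = f (fcross14 up1 low1 p).
Proof. by rewrite f_aut f_low1 f_up1. Qed.

Lemma scale6_eq0 (x : vec6) : x = scale6 (-1) x -> x = zero6.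
Proof.
have [n1 _ _] := neq1_N1_3_N3.
by move=> h; apply: vec6P; apply: (eq_scale0 n1); rewrite [in LHS]h.
Qed.

(** f commutes with [fcross14 up1 low1], whose eigenspace for 1 is the first summand; the other
    eigenvalues -1, -3 and 3 differ from 1. The next lemma treats the eigenvalue -1 in the same
    way. *)
Lemma f_inX x : f (inX x) = inX (phi x).
Proof.
have [n1 n3 n3'] := neq1_N1_3_N3.
have := f_eigen (inX x); rewrite !fcross14_up1_low1.
rewrite (_ : V14 _ _ (_ * vxi (inX x)) _ = inX x); last first.
  by apply: vec14P; try apply: vec6P; coords; ring.
rewrite /phi => /esym h; apply: vec14P => //.
- exact: scale6_eq0 (congr1 (@vY K) h).
- exact: eq_scale0 n3' (congr1 (@vxi K) h).
- exact: eq_scale0 n3 (congr1 (@veta K) h).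
Qed.

Lemma f_inY y : f (inY y) = inY (psi y).
Proof.
have [n1 n3 n3'] := neq1_N1_3_N3.
have := f_eigen (inY y); rewrite !fcross14_up1_low1.
rewrite (_ : V14 (vX (inY y)) _ _ _ = scale14 (-1) (inY y)); last first.
  by apply: vec14P; try apply: vec6P; coords; ring.
rewrite (lin14Z _ _ f_lin) /psi => h; apply: vec14P => //.
- exact: scale6_eq0 (congr1 (@vX K) h).
- have /= e := congr1 (@vxi K) h; apply: (eq_scale0 n3).
  by apply: oppr_inj; rewrite -mulN1r -e; ring.
- have /= e := congr1 (@veta K) h; apply: (eq_scale0 n3').
  by rewrite mulNr e mulN1r opprK.
Qed.

Lemma inX_lin k x y : add14 (scale14 k (inX x)) (inX y) =
  inX (add6 (scale6 k x) y) :> vec14.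
Proof. by apply: vec14P; try apply: vec6P; coords; ring. Qed.

Lemma phi_lin k x y :
  phi (add6 (scale6 k x) y) = add6 (scale6 k (phi x)) (phi y).
Proof. by rewrite /phi -inX_lin f_lin. Qed.

Lemma psiZ k y : psi (scale6 k y) = scale6 k (psi y).
Proof.
rewrite /psi -[RHS]/(vY (scale14 k (f (inY y)))) -(lin14Z _ _ f_lin).
by congr (vY (f _)); apply: vec14P; try apply: vec6P; coords; ring.
Qed.

(** The product of two elements of the first summand, applied to (0, 0, 1, 0), is a multiple of
    their sharp product, placed in the second summand. *)
Lemma phi_sharp x y : psi (sharp6 x y) = sharp6 (phi x) (phi y).
Proof.
have E (a b : vec6) :
    fcross14 (inX a) (inX b) up1 = inY (scale6 2 (sharp6 a b)).
  by apply: vec14P; try apply: vec6P; coords; ring.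
have n2 : (2 : K) != 0 by [].
apply: (scale6_inj n2); rewrite -psiZ.
have := f_aut (inX x) (inX y) up1; rewrite E f_up1 !f_inX E f_inY.
by move=> /(congr1 (@vY K)).
Qed.

(** The product of an element of the first summand with one of the second has (0, 0, 1, 0) as an
    eigenvector, and the pairing is the eigenvalue up to the factor 8. *)
Lemma phi_psi_dot x y : dot6 (phi x) (psi y) = dot6 x y.
Proof.
have E (a b : vec6) : fcross14 (inX a) (inY b) up1 = scale14 (dot6 a b) up1.
  by apply: vec14P; try apply: vec6P; coords; ring.
have := f_aut (inX x) (inY y) up1; rewrite E f_up1 f_inX f_inY E.
rewrite (lin14Z _ _ f_lin) f_up1.
by move=> /(congr1 (@vxi K)); rewrite /= !mulr1.
Qed.

Lemma det6_phi x : det6 (phi x) = det6 x.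
Proof.
have n6 : (6 : K) != 0 by [].
have E (a : vec6) : 6 * det6 a = dot6 a (sharp6 a a) by coords; ring.
by apply: (mulfI n6); rewrite !E -phi_sharp phi_psi_dot.
Qed.

Lemma dot6_inj (y z : vec6) : (forall x, dot6 x y = dot6 x z) -> y = z.
Proof.
move=> d; have n2 : (2 : K) != 0 by [].
have {}d x : dot6 x (add6 y (scale6 (-1) z)) = 0.
  have -> : dot6 x (add6 y (scale6 (-1) z)) = dot6 x y - dot6 x z.
    by coords; ring.
  by rewrite d subrr.
apply: vec6P; apply/eqP; rewrite -subr_eq0; apply/eqP.
- by rewrite -(d (V6 1 0 0 0 0 0)); coords; ring.
- by rewrite -(d (V6 0 1 0 0 0 0)); coords; ring.
- by rewrite -(d (V6 0 0 1 0 0 0)); coords; ring.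
- by apply: (mulfI n2); rewrite mulr0 -(d (V6 0 0 0 1 0 0)); coords; ring.
- by apply: (mulfI n2); rewrite mulr0 -(d (V6 0 0 0 0 1 0)); coords; ring.
- by apply: (mulfI n2); rewrite mulr0 -(d (V6 0 0 0 0 0 1)); coords; ring.
Qed.

(** Nondegeneracy of [dot6] makes [psi] the contragredient of [phi], hence the identity as well. *)
Lemma phi_id : (forall x, phi x = x) -> forall p, f p = p.
Proof.
move=> phix p.
have psiy y : psi y = y.
  by apply: dot6_inj => x; rewrite -[in LHS](phix x) phi_psi_dot.
have -> : p = add14 (add14 (inX (vX p)) (inY (vY p)))
    (add14 (scale14 (vxi p) up1) (scale14 (veta p) low1)).
  by apply: vec14P; try apply: vec6P; coords; ring.
by rewrite !(lin14D _ _ f_lin) !(lin14Z _ _ f_lin) f_low1 f_up1 f_inX f_inY phix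
  psiy.
Qed.

Definition e1 : vec6 := V6 1 0 0 0 0 0.
Definition e2 : vec6 := V6 0 1 0 0 0 0.
Definition e3 : vec6 := V6 0 0 1 0 0 0.

Lemma sharp_e1 z : sharp6 e1 z = V6 0 (v33 z) (v22 z) (- v23 z) 0 0.
Proof. by rewrite /e1; apply: vec6P; coords; ring. Qed.
Lemma sharp_e2 z : sharp6 e2 z = V6 (v33 z) 0 (v11 z) 0 (- v13 z) 0.
Proof. by rewrite /e2; apply: vec6P; coords; ring. Qed.
Lemma sharp_e3 z : sharp6 e3 z = V6 (v22 z) (v11 z) 0 0 0 (- v12 z).
Proof. by rewrite /e3; apply: vec6P; coords; ring. Qed.

(** Let y be the symmetric off-diagonal unit at (i, j). The relations [sharp6] e_i y = 0 and
    [sharp6] e_j y = 0 are preserved and force phi(y) = c_k y with k the third index; y # y = -2 e_i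
    # e_j gives c_k^2 = 1. The determinant gives c_1 c_2 c_3 = 1, so c_k = c_i c_j and phi is
    conjugation by diag(c_1, c_2, c_3). *)
Lemma phi_diag : phi e1 = e1 -> phi e2 = e2 -> phi e3 = e3 ->
  exists2 g, det3 g = 1 & forall x, phi x = conj6 g x.
Proof.
move=> phi1 phi2 phi3.
have psi0 : psi zero6 = zero6.
  have -> : zero6 = sharp6 e1 e1 by rewrite sharp_e1 /= oppr0.
  by rewrite phi_sharp phi1.
have off x y : sharp6 x y = zero6 -> phi x = x -> sharp6 x (phi y) = zero6.
  by move=> xy px; rewrite -{1}px -phi_sharp xy psi0.
have sq y z w : sharp6 y y = scale6 (-2) (sharp6 z w) ->
    phi z = z -> phi w = w -> sharp6 (phi y) (phi y) = scale6 (-2) (sharp6 z w).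
  by move=> h pz pw; rewrite -phi_sharp h psiZ phi_sharp pz pw.
have n2 : (-2 : K) != 0 by rewrite oppr_eq0.
have [c3 h3 q3] : exists2 c, phi (V6 0 0 0 0 0 1) = V6 0 0 0 0 0 c & c * c = 1.
  set y := V6 _ _ _ _ _ _.
  have := off e1 y; have := off e2 y; have := sq y e1 e2.
  rewrite !sharp_e1 !sharp_e2.
  case: (phi y) => z1 z2 z3 z4 z5 z6 /= h1 h2 h3.
  have [] : V6 0 z3 z2 (- z4) 0 0 = zero6.
    by apply: h3 => //; apply: vec6P => /=; rewrite ?oppr0.
  move=> z30 z20 /eqP; rewrite oppr_eq0 => /eqP z40.
  have [] : V6 z3 0 z1 0 (- z5) 0 = zero6.
    by apply: h2 => //; apply: vec6P => /=; rewrite ?oppr0.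
  move=> _ z10 /eqP; rewrite oppr_eq0 => /eqP z50.
  exists z6; first by rewrite z30 z20 z40 z10 z50.
  apply: (mulfI n2).
  have /(congr1 (@v33 K)) : sharp6 (V6 z1 z2 z3 z4 z5 z6) (V6 z1 z2 z3 z4 z5 z6)
      = scale6 (-2) (V6 0 0 1 (- 0) 0 0).
    by apply: h1 => //; rewrite /y; apply: vec6P; coords; ring.
  by rewrite z20 z10; coords => E; rewrite -[RHS]E; ring.
have [c2 h2 q2] : exists2 c, phi (V6 0 0 0 0 1 0) = V6 0 0 0 0 c 0 & c * c = 1.
  set y := V6 _ _ _ _ _ _.
  have := off e1 y; have := off e3 y; have := sq y e1 e3.
  rewrite !sharp_e1 !sharp_e3.
  case: (phi y) => z1 z2 z3 z4 z5 z6 /= h1 h2 h4.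
  have [] : V6 0 z3 z2 (- z4) 0 0 = zero6.
    by apply: h4 => //; apply: vec6P => /=; rewrite ?oppr0.
  move=> z30 z20 /eqP; rewrite oppr_eq0 => /eqP z40.
  have [] : V6 z2 z1 0 0 0 (- z6) = zero6.
    by apply: h2 => //; apply: vec6P => /=; rewrite ?oppr0.
  move=> _ z10 /eqP; rewrite oppr_eq0 => /eqP z60.
  exists z5; first by rewrite z30 z20 z40 z10 z60.
  apply: (mulfI n2).
  have /(congr1 (@v22 K)) : sharp6 (V6 z1 z2 z3 z4 z5 z6) (V6 z1 z2 z3 z4 z5 z6)
      = scale6 (-2) (V6 0 1 0 (- 0) 0 0).
    by apply: h1 => //; rewrite /y; apply: vec6P; coords; ring.
  by rewrite z30 z10; coords => E; rewrite -[RHS]E; ring.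
have [c1 h1 q1] : exists2 c, phi (V6 0 0 0 1 0 0) = V6 0 0 0 c 0 0 & c * c = 1.
  set y := V6 _ _ _ _ _ _.
  have := off e2 y; have := off e3 y; have := sq y e2 e3.
  rewrite !sharp_e2 !sharp_e3.
  case: (phi y) => z1 z2 z3 z4 z5 z6 /= h1 h5 h4.
  have [] : V6 z3 0 z1 0 (- z5) 0 = zero6.
    by apply: h4 => //; apply: vec6P => /=; rewrite ?oppr0.
  move=> z30 z10 /eqP; rewrite oppr_eq0 => /eqP z50.
  have [] : V6 z2 z1 0 0 0 (- z6) = zero6.
    by apply: h5 => //; apply: vec6P => /=; rewrite ?oppr0.
  move=> z20 _ /eqP; rewrite oppr_eq0 => /eqP z60.
  exists z4; first by rewrite z30 z20 z50 z10 z60.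
  apply: (mulfI n2).
  have /(congr1 (@v11 K)) : sharp6 (V6 z1 z2 z3 z4 z5 z6) (V6 z1 z2 z3 z4 z5 z6)
      = scale6 (-2) (V6 1 0 0 0 (- 0) 0).
    by apply: h1 => //; rewrite /y; apply: vec6P; coords; ring.
  by rewrite z30 z20; coords => E; rewrite -[RHS]E; ring.
have phiE x : phi x = V6 (v11 x) (v22 x) (v33 x) (c1 * v23 x) (c2 * v13 x)
    (c3 * v12 x).
  have phi0 : phi zero6 = zero6 by rewrite /phi; have /= -> := lin14_0 f_lin.
  have {1}-> : x = add6 (scale6 (v11 x) e1) (add6 (scale6 (v22 x) e2)
     (add6 (scale6 (v33 x) e3) (add6 (scale6 (v23 x) (V6 0 0 0 1 0 0))
     (add6 (scale6 (v13 x) (V6 0 0 0 0 1 0))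
     (add6 (scale6 (v12 x) (V6 0 0 0 0 0 1)) zero6))))).
    by rewrite /e1 /e2 /e3; apply: vec6P; coords; ring.
  rewrite !phi_lin h1 h2 h3 phi1 phi2 phi3 phi0 /e1 /e2 /e3.
  by apply: vec6P; coords; ring.
have n2' : (2 : K) != 0 by [].
(* The determinant of a matrix with zero diagonal is twice the product of its off-diagonal entries;
   it is compared at the matrix whose off-diagonal entries are all 1. *)
have cE : c1 * c2 * c3 = 1.
  have D a b c : det6 (V6 0 0 0 a b c) = 2 * (a * b * c) :> K by coords; ring.
  apply: (mulfI n2'); have := det6_phi (V6 0 0 0 1 1 1).
  by rewrite phiE /= !mulr1 !D !mulr1.
have c23 : c2 * c3 = c1.
  transitivity (c1 * c1 * (c2 * c3)); first by rewrite q1 mul1r.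
  by rewrite -[RHS]mulr1 -[in RHS]cE; ring.
have c13 : c1 * c3 = c2.
  transitivity (c2 * c2 * (c1 * c3)); first by rewrite q2 mul1r.
  by rewrite -[RHS]mulr1 -[in RHS]cE; ring.
have c12 : c1 * c2 = c3.
  transitivity (c3 * c3 * (c1 * c2)); first by rewrite q3 mul1r.
  by rewrite -[RHS]mulr1 -[in RHS]cE; ring.
exists (M3 c1 0 0 0 c2 0 0 0 c3); first by rewrite -cE; coords; ring.
move=> [x1 x2 x3 x4 x5 x6]; rewrite phiE; apply: vec6P; coords.
- by transitivity (c1 * c1 * x1); [rewrite q1 mul1r|ring].
- by transitivity (c2 * c2 * x2); [rewrite q2 mul1r|ring].
- by transitivity (c3 * c3 * x3); [rewrite q3 mul1r|ring].
- by transitivity (c2 * c3 * x4); [rewrite c23|ring].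
- by transitivity (c1 * c3 * x5); [rewrite c13|ring].
- by transitivity (c1 * c2 * x6); [rewrite c12|ring].
Qed.

Definition sq6 (u1 u2 u3 : K) : vec6 :=
  V6 (u1 * u1) (u2 * u2) (u3 * u3) (u2 * u3) (u1 * u3) (u1 * u2).

(** For a nonzero diagonal entry, u is its column divided by a square root of that entry. When x_11
    = 0, the vanishing principal minors make the first row and column zero, leaving a 2x2 block. *)
Lemma rank_one (x : vec6) : adj6 x = zero6 -> exists u1 u2 u3, x = sq6 u1 u2 u3.
Proof.
case: x => x1 x2 x3 x4 x5 x6 [] /= a1 a2 a3 a4 a5 a6.
have [x10|x10] := eqVneq x1 0; last first.
  pose s := sqrtC x1; have s2 : s * s = x1 by rewrite -expr2 sqrtCK.
  have s0 : s != 0 by rewrite sqrtC_eq0.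
  exists s, (x6 / s), (x5 / s); rewrite /sq6; congr V6 => //.
  - transitivity (x6 ^+ 2 / x1); last by rewrite -s2; field.
    by rewrite -(addr0 (x6 ^+ 2)) -a3; field.
  - transitivity (x5 ^+ 2 / x1); last by rewrite -s2; field.
    by rewrite -(addr0 (x5 ^+ 2)) -a2; field.
  - transitivity (x5 * x6 / x1); last by rewrite -s2; field.
    by rewrite -(subr0 (x5 * x6)) -a4; field.
  - by field.
  - by field.
have sq0 (t : K) : t * t = 0 -> t = 0.
  by move/eqP; rewrite mulf_eq0 orbb => /eqP.
have x60 : x6 = 0.
  by apply/sq0/oppr_inj; rewrite oppr0 -[RHS]a3 x10; ring.
have x50 : x5 = 0.
  by apply/sq0/oppr_inj; rewrite oppr0 -[RHS]a2 x10; ring.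
have [x20|x20] := eqVneq x2 0.
  have x40 : x4 = 0.
    by apply/sq0/oppr_inj; rewrite oppr0 -[RHS]a1 x20; ring.
  exists 0, 0, (sqrtC x3).
  by rewrite x10 x20 x40 x50 x60 /sq6 !(mul0r, mulr0) -expr2 sqrtCK.
pose s := sqrtC x2; have s2 : s * s = x2 by rewrite -expr2 sqrtCK.
have s0 : s != 0 by rewrite sqrtC_eq0.
exists 0, s, (x4 / s); rewrite x10 x50 x60 /sq6 !mul0r s2; congr V6.
- transitivity (x4 ^+ 2 / x2); last by rewrite -s2; field.
  by rewrite -(addr0 (x4 ^+ 2)) -a1; field.
- by field.
Qed.

Lemma phi_frame : exists2 g, det3 g = 1 &
  [/\ phi e1 = conj6 g e1, phi e2 = conj6 g e2 & phi e3 = conj6 g e3].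
Proof.
have R e : adj6 e = zero6 -> exists u1 u2 u3, phi e = sq6 u1 u2 u3.
  move=> ae; apply: rank_one; have n2 : (2 : K) != 0 by [].
  apply: (scale6_inj n2); rewrite -adj6E -phi_sharp adj6E ae.
  have -> : scale6 2 zero6 = zero6 :> vec6 by apply: vec6P; coords; ring.
  have /= := lin14_0 f_lin; rewrite /psi => ->.
  by apply: vec6P; coords.
have [|u1 [u2 [u3 hu]]] := R e1.
  by rewrite /e1; apply: vec6P; coords; ring.
have [|v1 [v2 [v3 hv]]] := R e2.
  by rewrite /e2; apply: vec6P; coords; ring.
have [|w1 [w2 [w3 hw]]] := R e3.
  by rewrite /e3; apply: vec6P; coords; ring.
pose g := M3 u1 v1 w1 u2 v2 w2 u3 v3 w3.
(* The image of the identity matrix e1 + e2 + e3 is g g^T, and phi preserves the determinant. *)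
have dg : det3 g ^+ 2 = 1.
  have := det6_phi (add6 (scale6 1 e1) (add6 (scale6 1 e2) e3)).
  rewrite !phi_lin hu hv hw => E.
  transitivity (det6 (add6 (scale6 1 (sq6 u1 u2 u3))
     (add6 (scale6 1 (sq6 v1 v2 v3)) (sq6 w1 w2 w3)))).
    by rewrite /g /sq6; coords; ring.
  by rewrite E /e1 /e2 /e3; coords; ring.
(* The vector u is determined only up to sign, and t = 1 or -1 makes the determinant 1. *)
pose h t := M3 (t * u1) v1 w1 (t * u2) v2 w2 (t * u3) v3 w3.
have C t : t * t = 1 -> [/\ phi e1 = conj6 (h t) e1,
    phi e2 = conj6 (h t) e2 & phi e3 = conj6 (h t) e3].
  move=> tt; rewrite hu hv hw /e1 /e2 /e3 /sq6 /h; split.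
  - rewrite -[LHS]scale6_1 -[in LHS]tt.
    by apply: vec6P; coords; ring.
  - by apply: vec6P; coords; ring.
  - by apply: vec6P; coords; ring.
move/eqP: dg; rewrite sqrf_eq1 => /orP[] /eqP dg.
  eexists; last by apply: (C 1); rewrite mulr1.
  by transitivity (det3 g); [rewrite /h /g; coords; ring|].
eexists; last by apply: (C (-1)); rewrite mulrNN mulr1.
transitivity (- det3 g); last by rewrite dg opprK.
by rewrite /h /g; coords; ring.
Qed.

End Frame.

(** * The generated subgroup is the whole group *)

Section Stabilizer.
Variable K : numClosedFieldType.
Local Notation vec14 := (vec14 K).
Local Notation fiso := (fiso K).
Local Notation slow1 := (sf (low1 : vec14)).
Local Notation sup1 := (sf (up1 : vec14)).

Definition act14 (a : fiso) (p : vec14) : vec14 := cof (a (sf p)).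

Lemma act14E (a : fiso) p : a (sf p) = sf (act14 a p).
Proof. by rewrite /act14 cofK. Qed.

Lemma act14_lin (a : fiso) : lin14 (act14 a).
Proof.
move=> k p q; apply: sf_inj; rewrite -act14E -!sfD -!sfZ -!act14E.
by have [la _] := fisoP a; rewrite la.
Qed.

Lemma act14_aut (a : fiso) : E7 K a -> aut14 (act14 a).
Proof.
move=> /E7P Ea p q r; have n8 : (8 : K)^-1 != 0 by rewrite invr_eq0.
apply: (scale14_inj n8); apply: sf_inj.
rewrite -fcrossE -(lin14Z _ _ (act14_lin a)) -act14E -fcrossE Ea.
by rewrite !act14E.
Qed.

(** Two divisions by elements from [gen_sl3]: the matrix of [phi_frame] makes the first block fix
    the diagonal idempotents, that of [phi_diag] then makes it the identity, and [phi_id]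
    concludes. *)
Lemma E7_gen_fix2 (a : fiso) : E7 K a ->
  a slow1 = slow1 -> a sup1 = sup1 -> gen a.
Proof.
have D (b : fiso) : b slow1 = slow1 -> act14 b low1 = low1.
  by move=> h; apply: sf_inj; rewrite -act14E.
have U (b : fiso) : b sup1 = sup1 -> act14 b up1 = up1.
  by move=> h; apply: sf_inj; rewrite -act14E.
have I (b : fiso) P Q : b P = Q -> (b^-1)%g Q = P by move=> <-; rewrite fisoK.
move=> Ea a1 au.
have [g dg [g1 g2 g3]] :=
  phi_frame (act14_lin a) (act14_aut Ea) (D _ a1) (U _ au).
have [b gb [b1 bu bX]] := gen_sl3 dg.
pose c := (b^-1 * a)%g.
have Ec : E7 K c by apply: E7M Ea; apply/E7V/gen_E7.
have c1 : c slow1 = slow1 by rewrite fisoME a1 (I _ _ _ b1).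
have cu : c sup1 = sup1 by rewrite fisoME au (I _ _ _ bu).
have cX e : phi (act14 a) e = conj6 g e -> phi (act14 c) e = e.
  move=> he; rewrite /phi /act14 fisoME act14E.
  rewrite (f_inX (act14_aut Ea) (D _ a1) (U _ au)) he.
  by rewrite (I _ _ _ (bX e)) sfK.
have [h dh hX] := phi_diag (act14_lin c) (act14_aut Ec) (D _ c1) (U _ cu)
  (cX _ g1) (cX _ g2) (cX _ g3).
have [b' gb' [b1' bu' bX']] := gen_sl3 dh.
pose c' := (b'^-1 * c)%g.
have Ec' : E7 K c' by apply: E7M Ec; apply/E7V/gen_E7.
have c1' : c' slow1 = slow1 by rewrite fisoME c1 (I _ _ _ b1').
have cu' : c' sup1 = sup1 by rewrite fisoME cu (I _ _ _ bu').
have c'1 : c' = 1%g.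
  apply: fisoP14 => p; rewrite act14E fiso1E; congr sf.
  apply: (phi_id (act14_lin c') (act14_aut Ec') (D _ c1') (U _ cu')) => x.
  rewrite /phi /act14 fisoME act14E.
  rewrite (f_inX (act14_aut Ec) (D _ c1) (U _ cu)) hX.
  by rewrite (I _ _ _ (bX' x)) sfK.
have -> : a = (b * b')%g.
  by rewrite -[b']mulg1 -c'1 /c' mulVKg /c mulVKg.
exact: genMg.
Qed.

(** With xi = 1 the equations of M read X = adj Y and eta = det Y, which is the orbit of (0, 0, 1,
    0) under the dual translations. *)
Lemma M14_xi1 (p : vec14) : M14 p -> vxi p = 1 -> p = tauV14 (vY p) up1.
Proof.
move=> /M14_eqs [h1 _ h3] xi1; have n3 : (3 : K) != 0 by [].
have xE : vX p = adj6 (vY p) by rewrite h1 xi1 scale6_1.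
have etaE : veta p = det6 (vY p).
  apply: (mulfI n3); have := h3; rewrite xi1 mul1r => <-.
  by rewrite det6E xE dot6C.
case: p xi1 xE etaE {h1 h3} => x y xi eta /= -> -> ->.
case: y => y1 y2 y3 y4 y5 y6.
by apply: vec14P; try apply: vec6P; coords; ring.
Qed.

Lemma E7_gen (a : fiso) : E7 K a -> gen a.
Proof.
move=> Ea.
have fM1 : fM K slow1.
  apply/fM_sf; split=> [r|].
    by apply: vec14P; try apply: vec6P; coords; ring.
  by move=> /(congr1 (@veta K)) /= /eqP; rewrite oner_eq0.
have fMu : fM K sup1.
  apply/fM_sf; split=> [r|].
    by apply: vec14P; try apply: vec6P; coords; ring.
  by move=> /(congr1 (@vxi K)) /= /eqP; rewrite oner_eq0.
have [b gb b1] := gen_trans (E7_fM Ea fM1).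
pose c := (b^-1 * a)%g.
have Ec : E7 K c by apply: E7M Ea; apply/E7V/gen_E7.
have c1 : c slow1 = slow1 by rewrite fisoME -b1 -sf_low1 fisoK.
have cd1 : act14 c low1 = low1 by apply: sf_inj; rewrite -act14E.
have := E7_fM Ec fMu; rewrite act14E; set q := act14 c _ => /fM_sf Mq.
have n3 : (3 : K) != 0 by [].
(* The last coordinate of [fcross14 p low1 low1] is 3 xi. As c fixes [low1] and carries [up1] to q,
   comparing the values at [up1] and q gives xi = 1 for q. *)
have xi1 : vxi q = 1.
  have h := act14_aut Ec up1 low1 low1.
  rewrite -/q cd1 in h.
  have E p : veta (fcross14 p low1 low1) = 3 * vxi p by coords; ring.
  have F : fcross14 up1 low1 low1 = scale14 3 low1 :> vec14.
    by apply: vec14P; try apply: vec6P; coords; ring.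
  apply: (mulfI n3); rewrite -E -h F (lin14Z _ _ (act14_lin c)) cd1.
  by coords; ring.
have qE := M14_xi1 Mq xi1.
have t1 (y : vec6 K) : tauV14 y low1 = low1.
  by apply: vec14P; try apply: vec6P; coords; ring.
(* [tauV (vY q)] fixes [low1] and sends [up1] to q, so the last factor fixes both. *)
have -> : a = (b * (tauV (vY q) * ((tauV (vY q))^-1 * c)))%g.
  by rewrite mulVKg /c mulVKg.
apply: genMg => //; apply: genMg; first exact: gen_tauV.
apply: E7_gen_fix2.
- by apply: E7M Ec; apply/E7V/gen_E7/gen_tauV.
- by rewrite fisoME c1 -[in LHS](t1 (vY q)) -tauVE fisoK.
- have hc : c sup1 = tauV (vY q) sup1 by rewrite act14E tauVE -qE.
  by rewrite fisoME hc fisoK.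
Qed.

End Stabilizer.

(** * Continuity at a point into initial and product topologies *)

Section ContinuityInitial.

Lemma cvg_initial (Y : choiceType) (Z : topologicalType) (w : Y -> Z)
    (X : topologicalType) (f : X -> initial_topology w) (x : X) :
  {for x, continuous (w \o f)} -> {for x, continuous f}.
Proof.
move=> cf U [?/= [[W oW <-]]] /= Wsfz /filterS; apply; apply: cf.
exact: open_nbhs_nbhs.
Qed.

Lemma cvg_ptws (U : choiceType) (V X : topologicalType)
    (f : X -> {ptws U -> V}) (x : X) :
  (forall u, {for x, continuous (fun y => f y u)}) -> {for x, continuous f}.
Proof.
move=> cf; apply/cvg_sup => u.
exact: (@cvg_initial _ _ (fun g : U -> V => g u) X f x (cf u)).
Qed.

Lemma continuous_fst_comp (U V X : topologicalType) (P : X -> U * V) (x : X) :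
  {for x, continuous P} -> {for x, continuous (fun y => (P y).1)}.
Proof. by move=> cP; apply: (cvg_comp _ _ cP); exact: cvg_fst. Qed.

Lemma continuous_snd_comp (U V X : topologicalType) (P : X -> U * V) (x : X) :
  {for x, continuous P} -> {for x, continuous (fun y => (P y).2)}.
Proof. by move=> cP; apply: (cvg_comp _ _ cP); exact: cvg_snd. Qed.

End ContinuityInitial.

(** * Continuity of the coordinate formulas and of the sections *)

Section Continuity.
Variable K : numClosedFieldType.
Local Notation vec6 := (vec6 K).
Local Notation vec14 := (vec14 K).
Local Notation fiso := (fiso K).
Variables (T : topologicalType) (x : T).
Implicit Types f g : T -> K.

(** Continuity at the fixed point [x] alone: the sections contain the inverse of eta, controlled
    only where eta is nonzero. *)
Definition ct f := {for x, continuous f}.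

Lemma ctC (c : K) : ct (fun=> c). Proof. exact: cvg_cst. Qed.
Lemma ctD f g : ct f -> ct g -> ct (fun y => f y + g y).
Proof. exact: cvgD. Qed.
Lemma ctN f : ct f -> ct (fun y => - f y).
Proof. exact: cvgN. Qed.
Lemma ctM f g : ct f -> ct g -> ct (fun y => f y * g y).
Proof. exact: cvgM. Qed.
Lemma ctX2 f : ct f -> ct (fun y => f y ^+ 2).
Proof. by move=> cf; exact: ctM. Qed.
Lemma ctV f : f x != 0 -> ct f -> ct (fun y => (f y)^-1).
Proof. exact: cvgV. Qed.

Record ct6 (v : T -> vec6) : Prop := Ct6 {
  ct11 : ct (fun y => v11 (v y)); ct22 : ct (fun y => v22 (v y));
  ct33 : ct (fun y => v33 (v y)); ct23 : ct (fun y => v23 (v y));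
  ct13 : ct (fun y => v13 (v y)); ct12 : ct (fun y => v12 (v y)) }.

Record ct14 (p : T -> vec14) : Prop := Ct14 {
  ctX_ : ct6 (fun y => vX (p y)); ctY_ : ct6 (fun y => vY (p y));
  ctxi : ct (fun y => vxi (p y)); cteta : ct (fun y => veta (p y)) }.

Lemma continuous_sm (v : T -> vec6) :
  ct6 v -> {for x, continuous (fun y => sm (v y))}.
Proof.
case=> h1 h2 h3 h4 h5 h6.
apply: (@cvg_initial _ _ (@symval K) T (fun y => sm (v y)) x).
move=> A [B /= hB BA].
have key i j : ct (fun y => symval (sm (v y)) i j).
  have -> : (fun y => symval (sm (v y)) i j) = (fun y => mx6 (v y) i j).
    by apply/funext => y; rewrite smE.
  elim/ord3_ind: i; elim/ord3_ind: j;
    (have E i j : (fun y => mx6 (v y) i j) = (fun y => nth 0 (nth [::]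
      [:: [:: v11 (v y); v12 (v y); v13 (v y)];
          [:: v12 (v y); v22 (v y); v23 (v y)];
          [:: v13 (v y); v23 (v y); v33 (v y)]] i) j)
       by apply/funext => y; rewrite mxE); rewrite E /=; assumption.
apply: filterS BA _ => /=.
(* A matrix neighbourhood contains a product of neighbourhoods of the nine entries, so finitely many
   entrywise conditions suffice. *)
have : \forall y \near x, forall ij : 'I_3 * 'I_3,
    B ij.1 ij.2 (symval (sm (v y)) ij.1 ij.2).
  by apply: filter_forall => -[i j]; exact: (key i j _ (hB i j)).
by apply: filterS => y h i j; exact: (h (i, j)).
Qed.

Lemma continuous_sf (p : T -> vec14) :
  ct14 p -> {for x, continuous (fun y => sf (p y))}.
Proof.
case=> hX hY hxi heta.
have cX := continuous_sm hX; have cY := continuous_sm hY.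
exact: (cvg_pair (cvg_pair (cvg_pair cX cY) hxi) heta).
Qed.

Lemma ct6_co6 (X : T -> symmx K) :
  {for x, continuous X} -> ct6 (fun y => co6 (X y)).
Proof.
move=> cX.
have key i j : ct (fun y => symval (X y) i j).
  have c1 : {for x, continuous (fun y => symval (X y))}.
    apply: (cvg_comp _ _ cX).
    exact: (@initial_continuous _ _ (@symval K) (X x)).
  exact: (cvg_comp _ (fun M : 'M[K]_3 => M i j) c1
    (@coord_continuous K 3 3 i j (symval (X x)))).
by split; exact: key.
Qed.

Lemma ct14_cof (P : T -> freud K) :
  {for x, continuous P} -> ct14 (fun y => cof (P y)).
Proof.
move=> cP.
have c1 := continuous_fst_comp cP; have c11 := continuous_fst_comp c1.
split.
- exact/ct6_co6/(continuous_fst_comp c11).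
- exact/ct6_co6/(continuous_snd_comp c11).
- exact: (continuous_snd_comp c1).
- exact: (continuous_snd_comp cP).
Qed.

Ltac ct_solve := cbv beta; lazymatch goal with
  | |- ct (fun=> ?c) => exact: ctC
  | |- ct (fun y => @?f y + @?g y) => apply: (@ctD f g); ct_solve
  | |- ct (fun y => - @?f y) => apply: (@ctN f); ct_solve
  | |- ct (fun y => @?f y * @?g y) => apply: (@ctM f g); ct_solve
  | |- ct (fun y => @?f y ^+ 2) => apply: (@ctX2 f); ct_solve
  | |- _ => assumption
  end.

Lemma ct6Z (k : T -> K) (a : T -> vec6) :
  ct k -> ct6 a -> ct6 (fun y => scale6 (k y) (a y)).
Proof. by move=> ? [? ? ? ? ? ?]; split=> /=; ct_solve. Qed.

Lemma ct6D (a b : T -> vec6) :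
  ct6 a -> ct6 b -> ct6 (fun y => add6 (a y) (b y)).
Proof. by move=> [? ? ? ? ? ?] [? ? ? ? ? ?]; split=> /=; ct_solve. Qed.

Lemma ct6_sharp (a b : T -> vec6) :
  ct6 a -> ct6 b -> ct6 (fun y => sharp6 (a y) (b y)).
Proof. by move=> [? ? ? ? ? ?] [? ? ? ? ? ?]; split=> /=; ct_solve. Qed.

Lemma ct6_adj (a : T -> vec6) : ct6 a -> ct6 (fun y => adj6 (a y)).
Proof. by move=> [? ? ? ? ? ?]; split=> /=; ct_solve. Qed.

Lemma ct_dot (a b : T -> vec6) :
  ct6 a -> ct6 b -> ct (fun y => dot6 (a y) (b y)).
Proof. by move=> [? ? ? ? ? ?] [? ? ? ? ? ?]; rewrite /dot6; ct_solve. Qed.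

Lemma ct_det (a : T -> vec6) : ct6 a -> ct (fun y => det6 (a y)).
Proof. by move=> [? ? ? ? ? ?]; rewrite /det6; ct_solve. Qed.

Lemma ct6_conj (g : T -> mat3 K) (a : T -> vec6) : ct6 a ->
  ct (fun y => m11 (g y)) -> ct (fun y => m12 (g y)) ->
  ct (fun y => m13 (g y)) ->
  ct (fun y => m21 (g y)) -> ct (fun y => m22 (g y)) ->
  ct (fun y => m23 (g y)) ->
  ct (fun y => m31 (g y)) -> ct (fun y => m32 (g y)) ->
  ct (fun y => m33 (g y)) ->
  ct6 (fun y => conj6 (g y) (a y)).
Proof. by move=> [? ? ? ? ? ?] *; split=> /=; rewrite /row6; ct_solve. Qed.

Lemma ct6_elem k (s : T -> K) (a : T -> vec6) :
  ct s -> ct6 a -> ct6 (fun y => conj6 (elem3 k (s y)) (a y)).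
Proof.
move=> cs ca; apply: ct6_conj => //.
all: by case: k => [|[|[|[|[|k]]]]] /=; ct_solve.
Qed.

Lemma ct14_tau (a : T -> vec6) (p : T -> vec14) :
  ct6 a -> ct14 p -> ct14 (fun y => tau14 (a y) (p y)).
Proof.
move=> ca [hX hY hxi heta]; split; rewrite /tau14; cbn [vX vY vxi veta].
- by apply: ct6D => //; exact: ct6Z.
- by apply: ct6D hY _; apply: ct6D; [exact: ct6_sharp|apply/ct6Z/ct6_adj].
- apply: ctD; last by apply: ctM => //; exact: ct_det.
  apply: ctD; last by apply: ct_dot => //; exact: ct6_adj.
  by apply: ctD => //; exact: ct_dot.
- by [].
Qed.

Lemma ct14_tauV (a : T -> vec6) (p : T -> vec14) :
  ct6 a -> ct14 p -> ct14 (fun y => tauV14 (a y) (p y)).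
Proof.
move=> ca [hX hY hxi heta]; split; rewrite /tauV14; cbn [vX vY vxi veta].
- by apply: ct6D hX _; apply: ct6D; [exact: ct6_sharp|apply/ct6Z/ct6_adj].
- by apply: ct6D => //; exact: ct6Z.
- by [].
- apply: ctD; last by apply: ctM => //; exact: ct_det.
  apply: ctD; last by apply: ct_dot => //; exact: ct6_adj.
  by apply: ctD => //; exact: ct_dot.
Qed.

Lemma ct14_lev k (s : T -> K) (p : T -> vec14) :
  ct s -> ct14 p -> ct14 (fun y => lev14 k (s y) (p y)).
Proof.
move=> cs [hX hY hxi heta]; split; rewrite /lev14; cbn [vX vY vxi veta] => //.
- exact: ct6_elem.
- by apply: ct6_elem => //; exact: ctN.
Qed.

Lemma ct14C (p : vec14) : ct14 (fun=> p).
Proof. by split; try split; exact: ctC. Qed.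

Lemma ct6C (p : vec6) : ct6 (fun=> p).
Proof. by split; exact: ctC. Qed.

Lemma continuous_fiso (a : T -> fiso) :
  (forall p, {for x, continuous (fun y => a y (sf p))}) ->
  {for x, continuous a}.
Proof.
move=> ca.
apply: (@cvg_initial _ _
  (@fiso_fun K : fiso -> {ptws freud K -> freud K}) T a x).
by apply: cvg_ptws => P; rewrite -[P]cofK; exact: ca.
Qed.

Lemma continuous_sf_ext (P : T -> freud K) (p : T -> vec14) :
  (forall y, P y = sf (p y)) -> ct14 p -> {for x, continuous P}.
Proof. by move=> /funext -> cp; exact: continuous_sf. Qed.

Lemma continuous_oneparam u (t : T -> K) (a : fiso) : oneparam u -> ct t ->
  {for x, continuous (fun y => u (t y) * a)%g}.
Proof.
move=> hu ht; apply: continuous_fiso => p.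
have ctp := ct14C (cof (a (sf p))).
have cz := ct6Z ht (ct6C _).
case: hu => [b|b|k].
- apply: (continuous_sf_ext
    (p := fun y => tau14 (scale6 (t y) b) (cof (a (sf p))))).
    by move=> y; rewrite fisoME -tauE cofK.
  by apply: ct14_tau => //; exact: cz.
- apply: (continuous_sf_ext
    (p := fun y => tauV14 (scale6 (t y) b) (cof (a (sf p))))).
    by move=> y; rewrite fisoME -tauVE cofK.
  by apply: ct14_tauV => //; exact: cz.
- apply: (continuous_sf_ext
    (p := fun y => lev14 k (t y) (cof (a (sf p))))).
    by move=> y; rewrite fisoME -levE cofK.
  exact: ct14_lev.
Qed.

(** Induction on the word: each generator acts by polynomials in the coordinates. *)
Lemma continuous_gen (a : fiso) (P : T -> freud K) : gen a ->
  {for x, continuous P} -> {for x, continuous (fun y => a (P y))}.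
Proof.
move=> ga; elim: ga P => [//|u t b hu _ IH] P /IH/ct14_cof cp.
case: hu => [c|c|k].
- apply: (continuous_sf_ext
    (p := fun y => tau14 (scale6 t c) (cof (b (P y))))).
    by move=> y; rewrite fisoME -tauE cofK.
  by apply: ct14_tau => //; exact: ct6C.
- apply: (continuous_sf_ext
    (p := fun y => tauV14 (scale6 t c) (cof (b (P y))))).
    by move=> y; rewrite fisoME -tauVE cofK.
  by apply: ct14_tauV => //; exact: ct6C.
- apply: (continuous_sf_ext
    (p := fun y => lev14 k t (cof (b (P y))))).
    by move=> y; rewrite fisoME -levE cofK.
  by apply: ct14_lev => //; exact: ctC.
Qed.

Lemma continuous_sect (a : fiso) (p : T -> vec14) : gen a -> ct14 p ->
  veta (p x) != 0 -> {for x, continuous (fun y => a * sect (p y))%g}.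
Proof.
move=> ga [hX hY hxi heta] e0; apply: continuous_fiso => r.
apply: (continuous_gen (P := fun y => sect (p y) (sf r))) => //.
apply: (continuous_sf_ext
    (p := fun y =>
  tau14 (scale6 (veta (p y))^-1 (add6 (vX (p y)) (scale6 (-1) (E11 1))))
  (tauV14 (E11 (veta (p y) - 1)) (tau14 (E11 1) r)))).
  by move=> y; rewrite /sect 2!fisoME tauE tauVE tauE.
apply: ct14_tau.
  by apply: ct6Z; [exact: ctV|apply: ct6D => //; exact: ct6C].
apply: ct14_tauV; last exact: ct14C.
by split => /=; ct_solve.
Qed.

End Continuity.

(** * The orbit map and its inverse *)

Section Homeomorphism.
Variable K : numClosedFieldType.
Local Notation fiso := (fiso K).
Local Notation Q := (E7_homogeneous K).
Local Notation M := (set_type (fM K)).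
Local Open Scope quotient_scope.

Lemma fM_dot1 : fM K (dot1 K).
Proof.
rewrite -sf_low1; apply/fM_sf; split=> [r|].
  by apply: vec14P; try apply: vec6P; coords; ring.
by move=> /(congr1 (@veta K)) /= /eqP; rewrite oner_eq0.
Qed.

Definition gen_elt (a : fiso) (ga : gen a) : E7 K :=
  exist _ a (mem_set (gen_E7 ga)).

Definition orbit_dot1 (a : E7 K) : M :=
  exist _ (set_val a (dot1 K)) (mem_set (E7_fM (set_mem (valP a)) fM_dot1)).

Lemma orbit_dot1E a b : (orbit_dot1 a = orbit_dot1 b) <->
  set_val a (dot1 K) = set_val b (dot1 K).
Proof. by split=> [/(congr1 val)|h] //; apply/val_inj. Qed.

Lemma pi_orbit_dot1 (a b : E7 K) :
  \pi_Q a = \pi_Q b <-> orbit_dot1 a = orbit_dot1 b.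
Proof.
rewrite orbit_dot1E; split.
  move=> /eqmodP/asboolP [_]; rewrite fisoME => h.
  by rewrite -[in LHS]h fisoVK.
move=> h; apply/eqmodP/asboolP; split.
  by apply: E7M; [apply: E7V|]; exact: set_mem (valP _).
by rewrite fisoME -h fisoK.
Qed.

Lemma continuous_eval (P : freud K) : continuous (fun a : fiso => a P).
Proof.
move=> a.
have c1 : {for a,
    continuous (@fiso_fun K : fiso -> {ptws freud K -> freud K})}.
  exact: (@initial_continuous _ _
    (@fiso_fun K : fiso -> {ptws freud K -> freud K}) a).
have c2 := @proj_continuous (freud K) (fun=> freud K) P (fiso_fun a).
exact: (cvg_comp _ _ c1 c2).
Qed.

Lemma continuous_orbit_dot1 : continuous orbit_dot1.
Proof.
apply: continuous_comp_initial => a.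
have c1 := @initial_continuous _ _ (set_val : E7 K -> fiso) a.
exact: (cvg_comp _ _ c1 (@continuous_eval (dot1 K) (set_val a))).
Qed.

Lemma orbit_lift (P : M) : exists a : E7 K, orbit_dot1 a = P.
Proof.
have [a ga aP] := gen_trans (set_mem (valP P)).
exists (gen_elt ga); exact: val_inj.
Qed.

Definition orbit_inv (P : M) : Q := \pi_Q (projT1 (cid (orbit_lift P))).

Lemma orbit_invE a P : orbit_dot1 a = P -> orbit_inv P = \pi_Q a.
Proof.
by move=> aP; apply/pi_orbit_dot1; rewrite aP; case: cid.
Qed.

Lemma continuous_orbit_inv : continuous orbit_inv.
Proof.
move=> P.
have := set_mem (valP P); rewrite -{1}[val P]cofK.
move=> /fM_sf [_ /quad_nonzero [b hb]].
pose p (R : M) := tauV14 b (cof (val R)).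
have cv : {for P, continuous (fun R : M => val R : freud K)}.
  exact: (@initial_continuous _ _ (set_val : M -> freud K) P).
have cp : ct14 P p by apply: ct14_tauV; [exact: ct6C|exact: ct14_cof].
have gp R : gen ((tauV b)^-1 * sect (p R))%g.
  exact: genMg (genV (gen_tauV _)) (gen_sect _).
(* [s] is defined on all of M, where the inverse of 0 is 0 by convention, but it lifts R only where
   the last coordinate of [p R] is nonzero. *)
pose s (R : M) : E7 K := gen_elt (gp R).
have sE R : veta (p R) != 0 -> orbit_inv R = \pi_Q (s R).
  move=> eR; apply: orbit_invE; apply: val_inj.
  change (((tauV b)^-1 * sect (p R))%g (dot1 K) = val R).
  have hM : M14 (p R).
    apply/fM_sf; rewrite -tauVE cofK; apply: E7_fM (set_mem (valP R)).
    exact/gen_E7/gen_tauV.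
  by rewrite fisoME -sf_low1 sect_low1 // -tauVE fisoK cofK.
have cs : {for P, continuous s}.
  apply: (@cvg_initial _ _ (set_val : E7 K -> fiso) M s P).
  exact: (continuous_sect (genV (gen_tauV b)) cp).
have cpi : {for P, continuous (fun R => \pi_Q (s R) : Q)}.
  apply: (cvg_comp _ _ cs); exact: (@pi_continuous (E7 K) _ (s P)).
move=> U; rewrite sE // => /cpi hU.
(* That coordinate is nonzero at P by the choice of b, hence near P, so there [orbit_inv] agrees
   with the continuous map R |-> \pi (s R). *)
have near0 : \forall R \near P, veta (p R) != 0.
  by have [_ _ _] := cp; move/cvgr_neq0; apply.
apply: (@filterS _ (nbhs P) _ _ _ _ (filterI near0 hU)) => N [eN] /=.
by rewrite -sE.
Qed.

Lemma homeomorphic_orbit : homeomorphic Q M.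
Proof.
exists (orbit_dot1 \o repr), orbit_inv; split.
- by move=> q /=; rewrite (orbit_invE (erefl _)) reprK.
- move=> P; rewrite /orbit_inv /=; case: cid => a aP /=.
  by rewrite -[RHS]aP; apply/pi_orbit_dot1; rewrite reprK.
- apply: repr_comp_continuous; first exact: continuous_orbit_dot1.
  by move=> a b /eqP/pi_orbit_dot1 ->.
- exact: continuous_orbit_inv.
Qed.

End Homeomorphism.

(** * Connectedness of the group over the complex field *)

Section Connected.
Variable R : realType.
Let C : numClosedFieldType := R[i].

Lemma continuous_real_complex (t : R) : ct (K := C) t (fun s : R => (s%:C)%C).
Proof.
apply/cvgrPdist_lt => e e0.
(* The radius e lies in [R[i]]; positivity there includes being real. *)
have [re0 imE] : 0 < complex.Re e /\ e = ((complex.Re e)%:C)%C.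
  by move: e0; case: e => a b; rewrite ltcE /= => /andP[/eqP -> ?].
have : \forall s \near t, `|t - s| < complex.Re e.
  by apply: nbhsx_ballx.
apply: filterS => s h.
rewrite imE -rmorphB /= normc_def /= expr0n /= addr0 sqrtr_sqr.
by rewrite ltcR.
Qed.

Lemma oneparam_connected u (t : C) (a : fiso C) : oneparam u -> E7 C a ->
  connected_component (E7 C) 1%g a ->
  connected_component (E7 C) 1%g (u t * a)%g.
Proof.
move=> hu Ea ca; apply: connected_component_trans ca _.
(* The image of the real line is connected, stays in [E7], and contains a at s = 0 and u(t) a at s =
   1. *)
pose path (s : R) : fiso C := (u ((s%:C)%C * t)%R * a)%g.
have cpath : continuous path.
  move=> s; apply: continuous_oneparam => //; apply: ctM; last exact: ctC.
  exact: continuous_real_complex.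
exists (range path); last first.
  by exists 1 => //; rewrite /path /= mul1r.
split.
- by exists 0 => //; rewrite /path mul0r oneparam0 // mul1g.
- by move=> _ [s _ <-]; apply: E7M => //; exact: oneparam_E7.
- apply: connected_continuous_connected; last exact: continuous_subspaceT.
  by apply/connected_intervalP => ? ? ? ? ? ?.
Qed.

Lemma E7_connected : connected (E7 C).
Proof.
have E1 : E7 C 1%g by exact: E7_1.
suff -> : E7 C = connected_component (E7 C) 1%g by exact: component_connected.
apply/seteqP; split; last exact: connected_component_sub.
move=> a /E7_gen; elim=> [|u t b hu gb IH].
  exact: connected_component_refl.
by apply: oneparam_connected => //; exact: gen_E7.
Qed.

End Connected.

Theorem theorem5p8 (R : realType) :
  homeomorphic (E7_homogeneous R[i]) (set_type (fM R[i])) /\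
  connected (E7 R[i]).
Proof. by split; [exact: homeomorphic_orbit | exact: E7_connected]. Qed.
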